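(* Let $A:=-\Delta+1$ on $\mathbb R^3$. (a) Assume $\sigma,s\in\mathbb R$, $b',b_1,b_2\ge0$ and $\sigma-2s-\frac32>0$. Then the inequality $$ \|A^{-1/2}(u\overline w)\|_{X_\pm^{\sigma,-b'}}\lesssim\|u\|_{X^{s,b_1}}\|w\|_{X^{s,b_2}} $$ is false (for either sign $\pm$), i.e. there is no constant $C$ such that it holds with constant $C$ for all $u,w$. (b) The same holds true if $s<-\frac14$: for $\sigma,s\in\mathbb R$, $b',b_1,b_2\ge0$ with $s<-\frac14$, the inequality in (a) is false.
   Context: Write $\langle x\rangle=(1+|x|^2)^{1/2}$. $X^{m,b}$ is the completion of $\mathcal S(\mathbb R^3\times\mathbb R)$ with respect to $\|f\|_{X^{m,b}}:=\|\langle\xi\rangle^m\langle\tau+|\xi|^2\rangle^b\widehat f(\xi,\tau)\|_{L^2_{\xi\tau}}$, and $X^{m,b}_\pm$ is the completion of $\mathcal S(\mathbb R^3\times\mathbb R)$ with respect to $\|f\|_{X^{m,b}_\pm}:=\|\langle\xi\rangle^m\langle\tau\pm|\xi|\rangle^b\widehat f(\xi,\tau)\|_{L^2_{\xi\tau}}$, where $\widehat f$ is the space-time Fourier transform. $X\lesssim Y$ means $X\le CY$ with a constant $C$ independent of the functions. *)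

(* Defs.v *)
From mathcomp Require Import all_boot all_order all_algebra.
From mathcomp Require Import all_classical all_reals all_analysis.
From mathcomp Require Import complex.

Set Implicit Arguments.
Unset Strict Implicit.
Unset Printing Implicit Defensive.

Import Order.TTheory GRing.Theory Num.Theory.
Import numFieldNormedType.Exports.

Local Open Scope classical_set_scope.
Local Open Scope ring_scope.
Local Open Scope complex_scope.

(* R^3 is R * R * R, and a point of space-time
   R^3 x R is z = (x, t) with x = z.1 and t = z.2; on the Fourier side
   z.1 = xi and z.2 = tau. *)
Notation space3 R := (R * R * R)%type.
Notation spacetime R := (R * R * R * R)%type.

Definition leb3 {R : realType} :=
  ((@lebesgue_measure R \x @lebesgue_measure R) \x @lebesgue_measure R)%E.

Definition leb4 {R : realType} := (@leb3 R \x @lebesgue_measure R)%E.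

Definition dot {R : realType} (x y : space3 R) : R :=
  x.1.1 * y.1.1 + x.1.2 * y.1.2 + x.2 * y.2.

Definition enorm {R : realType} (x : space3 R) : R := Num.sqrt (dot x x).

(* <y> = (1 + y^2)^{1/2} for a real y; for a vector x, <x> is jap (enorm x). *)
Definition jap {R : realType} (y : R) : R := Num.sqrt (1 + y ^+ 2).

Definition expi {R : realType} (y : R) : R[i] := cos y +i* sin y.

Definition cintegral {R : realType} {d : measure_display}
    {T : measurableType d} (mu : {measure set T -> \bar R}) (f : T -> R[i]) :
    R[i] :=
  (\int[mu]_x complex.Re (f x)) +i* (\int[mu]_x complex.Im (f x)).

(* [:: v1; ...; vk] |-> D_v1 ... D_vk g. *)
Definition iter_derive {R : realType} {V : normedModType R}
    (vs : seq V) (g : V -> R) : V -> R :=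
  foldr (fun v (h : V -> R) (x : V) => 'D_v h x) g vs.

(* All iterated directional derivatives exist everywhere and decay faster than
   any power.  Since the derivatives of each order are then bounded, g is
   automatically C^infinity, so this is the usual Schwartz class; the choice of
   the norm on a finite-dimensional V is immaterial. *)
Definition schwartz_real {R : realType} {V : normedModType R} (g : V -> R) :
    Prop :=
  forall vs : seq V,
    (forall x v, derivable (iter_derive vs g) x v) /\
    (forall N : nat, exists C : R, forall x,
       (1 + `|x|) ^+ N * `|iter_derive vs g x| <= C).

Definition schwartz {R : realType} (f : spacetime R -> R[i]) : Prop :=
  schwartz_real (fun z => complex.Re (f z)) /\
  schwartz_real (fun z => complex.Im (f z)).

Definition fourier {R : realType} (f : spacetime R -> R[i]) :
    spacetime R -> R[i] :=
  fun zeta =>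
    cintegral leb4 (fun z => expi (- (dot z.1 zeta.1 + z.2 * zeta.2)) * f z).

Definition fourier3 {R : realType} (g : space3 R -> R[i]) : space3 R -> R[i] :=
  fun xi => cintegral leb3 (fun x => expi (- dot x xi) * g x).

Definition inv_fourier3 {R : realType} (h : space3 R -> R[i]) :
    space3 R -> R[i] :=
  fun x => (((2 * pi) ^- 3)%:C)
           * cintegral leb3 (fun xi => expi (dot x xi) * h xi).

(* A = -Delta + 1 acts in the space variable only and is the Fourier multiplier
   with symbol |xi|^2 + 1; its real powers A^a are given by the functional
   calculus, i.e. by the symbols (|xi|^2 + 1)^a. *)
Definition symbolA {R : realType} (xi : space3 R) : R := enorm xi ^+ 2 + 1.

Definition powA {R : realType} (a : R) (f : spacetime R -> R[i]) :
    spacetime R -> R[i] :=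
  fun z => inv_fourier3
    (fun xi => ((symbolA xi `^ a)%:C) * fourier3 (fun x => f (x, z.2)) xi) z.1.

(* || <xi>^m <phi(xi, tau)>^b fhat ||_{L^2}, valued in [0, +oo]. *)
Definition weighted_norm {R : realType} (phi : spacetime R -> R) (m b : R)
    (f : spacetime R -> R[i]) : \bar R :=
  Lnorm leb4 2%:E (fun zeta =>
    (jap (enorm zeta.1) `^ m * jap (phi zeta) `^ b
     * Normc.normc (fourier f zeta))%:E).

Definition Xnorm {R : realType} (m b : R) (f : spacetime R -> R[i]) : \bar R :=
  weighted_norm (fun zeta => zeta.2 + enorm zeta.1 ^+ 2) m b f.

(* e = false is the norm of X_+ (weight <tau + |xi|>), e = true that of X_-. *)
Definition Xpm_norm {R : realType} (e : bool) (m b : R)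
    (f : spacetime R -> R[i]) : \bar R :=
  weighted_norm (fun zeta => zeta.2 + (-1) ^+ e * enorm zeta.1) m b f.

(* || A^{-1/2}(u wbar) ||_{X_pm^{sigma,-b'}} <= C ||u||_{X^{s,b1}} ||w||_{X^{s,b2}}
   with one constant C.  The product u wbar is defined on the dense subspace of
   Schwartz functions; on the completions it only has a meaning as the continuous
   bilinear extension, for which the estimate holds with the same constant. *)
Definition bilinear_estimate {R : realType} (e : bool)
    (sigma s b' b1 b2 : R) : Prop :=
  exists C : R, forall u w : spacetime R -> R[i],
    schwartz u -> schwartz w ->
    (Xpm_norm e sigma (- b')%R
         (powA (- 2^-1)%R (fun z => u z * conjc (w z))%R)
       <= C%:E * Xnorm s b1 u * Xnorm s b2 w)%E.

(* Main.v *)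
(* Both estimates are tested on Gaussian wave packets u, w whose Fourier transforms
   are Gaussians of width 1/N in xi_1 and 1 in xi_2, xi_3, tau, centred at
   (k, 0, 0, -k^2) on the paraboloid,
     so that <tau + |xi|^2> is of size 1 on them
   and ||u||_{X^{s,b}} <= C N^{s+1/2} as long as |k| ~ N.  The product of u with
   the conjugate of w is again a wave packet, at frequency (m, 0, 0,
     -(k1^2-k2^2))
   with m = k1 - k2.  If k1^2 - k2^2 = +-m this frequency lies on the light
     cone,
   <tau +- |xi|> is of size 1,
     and ||A^{-1/2}(u wbar)|| >= c <m>^{sigma-1} N^{1/2}.
   Hence <m>^{sigma-1} <= K N^{2s+1/2}.  Choosing k1 + k2 = +-1 and m = N
     excludes
   sigma - 2s - 3/2 > 0; choosing k1 = k2 = N, m = 0 excludes s < -1/4.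

   The Fourier transform of A^{-1/2} applied to a packet is computed from
   S^{-1/2} = pi^{-1/2} \int exp(-y^2 S) dy: for fixed y the multiplier
   exp(-y^2 (|xi|^2 + 1)) maps Gaussians to explicit Gaussians, so that Fubini's
   theorem replaces the general Fourier inversion theorem. *)

(* The width 1/N is dictated by the paraboloid: near frequency k of size N, |xi|^2 varies at rate 2k
   along xi_1, so only |xi_1 - k| of order 1/N keeps <tau + |xi|^2> bounded. On such packets the
   weights with exponents b1, b2 and b' are harmless, which is why these exponents do not appear in
   the final inequality. Gaussians have tails, so bounded means bounded by a power of 1 + D, where D
   is the quadratic [deviation] from the centre of the packet. Such a power is paid for by a factor
   e^{D/8}: in the upper bounds e^{-D/4} weakens to e^{-D/8}, in the lower bound e^{-D/8} weakens to
   e^{-D/4}. Afterwards only L^2 norms of pure Gaussians remain. Power counting: the Fourier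
   transform of a packet has height of order N on a region of volume of order 1/N, hence L^2 norm of
   order N^{1/2}. The two factors give N^{2s+1}, the product gives N^{1/2}, and the quotient is
   N^{2s+1/2}. The product is taken in physical space, where Gaussians multiply to Gaussians, so
   neither a convolution theorem nor Plancherel enters. *)
Require Import Defs.
From HB Require Import structures.
From mathcomp Require Import all_boot all_order all_algebra.
From mathcomp Require Import all_classical all_reals all_analysis.
From mathcomp Require Import measurable_realfun lebesgue_integral_under.
From mathcomp Require Import complex ring lra.

Set Implicit Arguments.
Unset Strict Implicit.
Unset Printing Implicit Defensive.

Import Order.TTheory GRing.Theory Num.Theory.
Import numFieldNormedType.Exports.

Local Open Scope classical_set_scope.
Local Open Scope complex_scope.
Local Open Scope ring_scope.

(** * Integration of complex-valued functions *)

Section ProductMeasure.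
Context {d1 d2 : measure_display} {T1 : measurableType d1}
  {T2 : measurableType d2} {R : realType}.
Variables (m1 : {sigma_finite_measure set T1 -> \bar R})
  (m2 : {sigma_finite_measure set T2 -> \bar R}).

(** Increasing exhaustions are chosen so that the diagonal rectangles suffice: a point of [F n]
    times [G k] lies in the rectangle of index [maxn n k]. *)
Lemma product_sigma_finite : sigma_finite setT (m1 \x m2)%E.
Proof.
have /sigma_finiteP[F [TF ndF Foo]] := sigma_finiteT m1.
have /sigma_finiteP[G [TG ndG Goo]] := sigma_finiteT m2.
exists (fun n => F n `*` G n).
  rewrite -setXTT TF TG; apply/seteqP; split => -[x y] /=.
    move=> [[n _ Fnx] [k _ Gky]]; exists (maxn n k) => //; split.
    - by move: x Fnx; exact/subsetPset/ndF/leq_maxl.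
    - by move: y Gky; exact/subsetPset/ndG/leq_maxr.
  by move=> [n _ []/= ? ?]; split; exists n.
move=> k; have [? ?] := Foo k; have [? ?] := Goo k.
split; first exact: measurableX.
by rewrite product_measure1E// lte_mul_pinfty// ge0_fin_numE.
Qed.

(* The library declares the sigma-finite structure of [m1 \x m2] only for
   subprobabilities, so that iterated products need this packaging. *)
Definition sfprod : {sigma_finite_measure set (T1 * T2)%type -> \bar R} :=
  HB.pack (m1 \x m2)%E
    (Measure_isSigmaFinite.Build _ _ _ (m1 \x m2)%E product_sigma_finite).

Lemma integrable_Rintegral (f : T1 * T2 -> R) :
  (m1 \x m2)%E.-integrable setT (EFin \o f) ->
  m1.-integrable setT (EFin \o (fun x => \int[m2]_y f (x, y))).
Proof.
move=> fi; have Fi := integrable_fubini_F fi.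
apply: le_integrable Fi => //.
  apply/measurable_EFinP; apply: measurableT_comp => //.
  exact: measurable_fubini_F fi.
move=> x _ /=; rewrite /Rintegral /fubini_F /=.
(* [fine] sends an infinite value to 0, so the bound holds also at the exceptional points whose
   section is not integrable. *)
by case: (integral _ _ _) => //= *; rewrite leey.
Qed.

(** The real and the extended iterated integrals agree only where the section integral is finite,
    which Fubini guarantees almost everywhere; this is enough to equate the outer integrals. *)
Lemma Rintegral_prod (f : T1 * T2 -> R) :
  (m1 \x m2)%E.-integrable setT (EFin \o f) ->
  \int[(m1 \x m2)%E]_z f z = \int[m1]_x \int[m2]_y f (x, y).
Proof.
move=> fi; rewrite {1}/Rintegral -integral12_prod_meas1//.
congr fine; apply: ae_eq_integral => //.
- exact: measurable_fubini_F fi.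
- exact: measurable_int (integrable_Rintegral fi).
- have := integrable_ae measurableT (integrable_fubini_F fi).
  by apply: filterS => x /(_ I) h _ /=; rewrite /Rintegral fineK.
Qed.

Lemma Rintegral_prod_swap (f : T1 * T2 -> R) :
  (m1 \x m2)%E.-integrable setT (EFin \o f) ->
  \int[(m1 \x m2)%E]_z f z = \int[m2]_y \int[m1]_x f (x, y).
Proof.
move=> fi; rewrite {1}/Rintegral -integral21_prod_meas1//.
congr fine; apply: ae_eq_integral => //.
- exact: measurable_fubini_G fi.
- apply/measurable_EFinP; apply: measurableT_comp => //.
  exact: measurable_fubini_G fi.
- have := ae_integrable2 fi; apply: filterS => y h _ /=.
  by rewrite /Rintegral fineK//; exact: integrable_fin_num h.
Qed.

Lemma integrable_mul_prod (f : T1 -> R) (g : T2 -> R) :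
  m1.-integrable setT (EFin \o f) -> m2.-integrable setT (EFin \o g) ->
  (m1 \x m2)%E.-integrable setT (EFin \o (fun z => f z.1 * g z.2)).
Proof.
move=> fi gi.
have mf : measurable_fun setT f by exact/measurable_EFinP/(measurable_int _ fi).
have mg : measurable_fun setT g by exact/measurable_EFinP/(measurable_int _ gi).
have mfg : measurable_fun setT (EFin \o (fun z : T1 * T2 => f z.1 * g z.2)).
  by apply/measurable_EFinP/measurable_funM; apply: measurableT_comp.
apply/(integrable12ltyP _ _ mfg).
have G0 : (0 <= \int[m2]_y `|(g y)%:E|)%E by exact: integral_ge0.
have Gfin : (\int[m2]_y `|(g y)%:E|)%E \is a fin_num.
  by rewrite ge0_fin_numE//; case/integrableP: gi.
under eq_integral => x _.
  under eq_integral do rewrite /= normrM EFinM.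
  rewrite ge0_integralZl//; last first.
    by apply/measurable_EFinP; apply: measurableT_comp.
  over.
rewrite ge0_integralZr//; last first.
  by apply/measurable_EFinP; apply: measurableT_comp.
rewrite lte_mul_pinfty//; first exact: integral_ge0.
- by rewrite ge0_fin_numE; [case/integrableP: fi|exact: integral_ge0].
- by case/integrableP: gi.
Qed.

Lemma Rintegral_mul_prod (f : T1 -> R) (g : T2 -> R) :
  m1.-integrable setT (EFin \o f) -> m2.-integrable setT (EFin \o g) ->
  \int[(m1 \x m2)%E]_z (f z.1 * g z.2) = (\int[m1]_x f x) * (\int[m2]_y g y).
Proof.
move=> fi gi; rewrite Rintegral_prod; last exact: integrable_mul_prod.
rewrite -RintegralZr//; apply: eq_Rintegral => x _ /=.
by rewrite RintegralZl.
Qed.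

End ProductMeasure.

Section ComplexIntegral.
Context {d : measure_display} {T : measurableType d} {R : realType}.
Implicit Types (mu : {measure set T -> \bar R}) (f g : T -> R[i]).

Definition cintegrable mu f :=
  mu.-integrable setT (EFin \o (fun x => complex.Re (f x))) /\
  mu.-integrable setT (EFin \o (fun x => complex.Im (f x))).

Lemma integrableZl_EFin mu (c : R) (f : T -> R) :
  mu.-integrable setT (EFin \o f) ->
  mu.-integrable setT (EFin \o (fun x => c * f x)).
Proof.
by move=> /(integrableZl measurableT c); apply: eq_integrable.
Qed.

Lemma cintegralZl mu (c : R[i]) f : cintegrable mu f ->
  cintegral mu (fun x => c * f x) = c * cintegral mu f.
Proof.
case: c => a b [fr fi].
rewrite /cintegral; apply/eqP; rewrite eq_complex; apply/andP; split;
  apply/eqP => /=.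
- rewrite -!RintegralZl//= -RintegralB//=.
  + by apply: eq_Rintegral => x _; case: (f x).
  + by apply: integrableZl fr.
  + by apply: integrableZl fi.
- rewrite -!RintegralZl//= -RintegralD//=.
  + by apply: eq_Rintegral => x _; case: (f x) => /= ? ?; rewrite addrC.
  + by apply: integrableZl fi.
  + by apply: integrableZl fr.
Qed.

Lemma cintegrableZl mu (c : R[i]) f :
  cintegrable mu f -> cintegrable mu (fun x => c * f x).
Proof.
case: c => a b [fr fi]; split.
- apply: (eq_integrable measurableT (fun x =>
  a%:E * (complex.Re (f x))%:E - b%:E * (complex.Im (f x))%:E)%E).
    by move=> x _ /=; case: (f x).
  by apply: integrableB => //; apply: integrableZl.
- apply: (eq_integrable measurableT (fun x =>
  a%:E * (complex.Im (f x))%:E + b%:E * (complex.Re (f x))%:E)%E).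
    by move=> x _ /=; case: (f x).
  by apply: integrableD => //; apply: integrableZl.
Qed.

Lemma cintegral_real mu (f : T -> R) :
  cintegral mu (fun x => (f x)%:C) = (\int[mu]_x f x)%:C.
Proof. by rewrite /cintegral /= Rintegral_cst ?mul0r. Qed.

Lemma cintegrable_real mu (f : T -> R) :
  mu.-integrable setT (EFin \o f) -> cintegrable mu (fun x => (f x)%:C).
Proof.
by split => //=; apply: eq_integrable (integrable0 mu setT).
Qed.

Lemma integrable_unit_mul mu (h f : T -> R) :
  measurable_fun setT h -> (forall x, `|h x| <= 1) ->
  mu.-integrable setT (EFin \o f) ->
  mu.-integrable setT (EFin \o (fun x => h x * f x)).
Proof.
move=> mh h1 fi; have mf : measurable_fun setT f.
  exact/measurable_EFinP/(measurable_int _ fi).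
apply: le_integrable fi => //; first exact/measurable_EFinP/measurable_funM.
by move=> x _ /=; rewrite lee_fin normrM ler_piMl.
Qed.

Lemma cintegrable_expiM mu (a : T -> R) f :
  measurable_fun setT a -> cintegrable mu f ->
  cintegrable mu (fun x => expi (a x) * f x).
Proof.
move=> ma [fr fi].
have mc : measurable_fun setT (cos \o a).
  apply: measurableT_comp => //.
  by apply: continuous_measurable_fun; exact: continuous_cos.
have ms : measurable_fun setT (sin \o a).
  apply: measurableT_comp => //.
  by apply: continuous_measurable_fun; exact: continuous_sin.
have c1 x : `|cos (a x)| <= 1 by rewrite ler_norml cos_geN1 cos_le1.
have s1 x : `|sin (a x)| <= 1 by rewrite ler_norml sin_geN1 sin_le1.
split.
- have := integrableB measurableT (integrable_unit_mul mc c1 fr)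
  (integrable_unit_mul ms s1 fi).
  by apply: eq_integrable => // x _ /=; case: (f x).
- have := integrableD measurableT (integrable_unit_mul mc c1 fi)
  (integrable_unit_mul ms s1 fr).
  by apply: eq_integrable => // x _ /=; case: (f x).
Qed.

Lemma cintegrable_wave mu (a : T -> R) (r : T -> R) :
  measurable_fun setT a -> mu.-integrable setT (EFin \o r) ->
  cintegrable mu (fun x => expi (a x) * (r x)%:C).
Proof. by move=> ma ri; apply: cintegrable_expiM => //;
  exact: cintegrable_real. Qed.

End ComplexIntegral.

Section ComplexFubini.
Context {d1 d2 : measure_display} {T1 : measurableType d1}
  {T2 : measurableType d2} {R : realType}.
Variables (m1 : {sigma_finite_measure set T1 -> \bar R})
  (m2 : {sigma_finite_measure set T2 -> \bar R}).

Lemma cintegral_prod (f : T1 * T2 -> R[i]) : cintegrable (m1 \x m2)%E f ->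
  cintegral (m1 \x m2)%E f = cintegral m1 (fun x => cintegral m2 (fun y =>
    f (x, y))).
Proof. by move=> [fr fi]; rewrite /cintegral/= !Rintegral_prod. Qed.

Lemma cintegral_prod_swap (f : T1 * T2 -> R[i]) : cintegrable (m1 \x m2)%E f ->
  cintegral (m1 \x m2)%E f = cintegral m2 (fun y => cintegral m1 (fun x =>
    f (x, y))).
Proof. by move=> [fr fi]; rewrite /cintegral/= !Rintegral_prod_swap. Qed.

Lemma cintegrable_cintegral (f : T1 * T2 -> R[i]) : cintegrable (m1 \x m2)%E f
  ->
  cintegrable m1 (fun x => cintegral m2 (fun y => f (x, y))).
Proof. by move=> [fr fi]; split;
  [exact: integrable_Rintegral fr|exact: integrable_Rintegral fi]. Qed.

Lemma cintegrable_mul_prod (f : T1 -> R[i]) (g : T2 -> R[i]) :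
  cintegrable m1 f -> cintegrable m2 g ->
  cintegrable (m1 \x m2)%E (fun z => f z.1 * g z.2).
Proof.
move=> [fr fi] [gr gi]; split.
- apply: (eq_integrable measurableT (fun z =>
  (complex.Re (f z.1) * complex.Re (g z.2))%:E - (complex.Im (f z.1) *
  complex.Im (g z.2))%:E)%E).
    by move=> z _ /=; case: (f z.1); case: (g z.2).
  exact: integrableB (integrable_mul_prod fr gr) (integrable_mul_prod fi gi).
- apply: (eq_integrable measurableT (fun z =>
  (complex.Re (f z.1) * complex.Im (g z.2))%:E + (complex.Im (f z.1) *
  complex.Re (g z.2))%:E)%E).
    by move=> z _ /=; case: (f z.1); case: (g z.2).
  exact: integrableD (integrable_mul_prod fr gi) (integrable_mul_prod fi gr).
Qed.

Lemma cintegral_mul_prod (f : T1 -> R[i]) (g : T2 -> R[i]) :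
  cintegrable m1 f -> cintegrable m2 g ->
  cintegral (m1 \x m2)%E (fun z =>
    f z.1 * g z.2) = cintegral m1 f * cintegral m2 g.
Proof.
move=> fi gi; rewrite cintegral_prod; last first.
  exact: cintegrable_mul_prod fi gi.
rewrite mulrC -cintegralZl//; congr cintegral; apply/funext => x /=.
by rewrite mulrC -cintegralZl.
Qed.

End ComplexFubini.

(** * The Fourier transform of a Gaussian *)

Section GaussFourier.
Context {R : realType}.
Local Notation mu := (@lebesgue_measure R).

Definition gauss (A m x : R) : R := expR (- (A * (x - m) ^+ 2)).

Lemma gauss_ge0 A m x : 0 <= gauss A m x. Proof. exact: expR_ge0. Qed.

Lemma measurable_gauss A m : measurable_fun setT (gauss A m).
Proof.
apply: measurableT_comp => //; apply: measurableT_comp => //.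
apply: measurable_funM => //; apply: measurable_funX.
exact: measurable_funB.
Qed.

(** Rate [A] means variance [1 / (2 * A)]; through this identity, integrability and the total mass
    are inherited from the normal density. *)
Lemma gauss_normal_pdf A m x : 0 < A ->
  gauss A m x = Num.sqrt (pi / A) * normal_pdf m (Num.sqrt (2 * A)^-1) x.
Proof.
move=> A0; have s0 : 0 < Num.sqrt (2 * A)^-1.
  by rewrite sqrtr_gt0 invr_gt0 mulr_gt0.
rewrite /normal_pdf gt_eqF//= /normal_peak /normal_fun.
rewrite sqr_sqrtr ?invr_ge0 ?mulr_ge0 ?ltW//.
have -> : (2 * A)^-1 * pi *+ 2 = pi / A :> R.
  by rewrite -mulr_natr; field; rewrite gt_eqF.
rewrite mulrA divff ?mul1r; last by rewrite gt_eqF// sqrtr_gt0 divr_gt0 ?pi_gt0.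
rewrite /gauss; congr expR; rewrite -mulr_natr; field.
by rewrite gt_eqF.
Qed.

Lemma integrable_gauss A m : 0 < A -> mu.-integrable setT (EFin \o gauss A m).
Proof.
move=> A0; have := integrable_normal_pdf m (Num.sqrt (2 * A)^-1).
move=> /(integrableZl measurableT (Num.sqrt (pi / A))).
by apply: eq_integrable => // x _ /=; rewrite gauss_normal_pdf.
Qed.

Lemma integral_gauss A m : 0 < A ->
  (\int[mu]_x (gauss A m x)%:E)%E = (Num.sqrt (pi / A))%:E.
Proof.
move=> A0; under eq_integral do rewrite gauss_normal_pdf// EFinM.
rewrite integralZl//; last exact: integrable_normal_pdf.
by rewrite integral_normal_pdf mule1.
Qed.

Lemma Rintegral_gauss A m : 0 < A -> \int[mu]_x gauss A m x = Num.sqrt (pi / A).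
Proof. by move=> A0; rewrite /Rintegral integral_gauss. Qed.

Lemma Rintegral_pushforward_lebesgue (phi : R -> R) (f : R -> R) :
  measurable_fun setT phi -> measurable_fun setT f ->
  (forall A, measurable A -> pushforward mu phi A = mu A) ->
  mu.-integrable setT (EFin \o (f \o phi)) ->
  \int[mu]_x f (phi x) = \int[mu]_x f x.
Proof.
move=> mphi mf pE fi; rewrite /Rintegral; congr fine.
rewrite -[LHS](@integral_pushforward _ _ (measurableTypeR R) (measurableTypeR
  R) R phi mphi mu setT (EFin \o f))//.
- by apply: eq_measure_integral => A mA _; exact: pE.
- exact/measurable_EFinP.
Qed.

Lemma Rintegral_shift (f : R -> R) (h : R) : measurable_fun setT f ->
  mu.-integrable setT (EFin \o (fun x => f (x - h))) ->
  \int[mu]_x f (x - h) = \int[mu]_x f x.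
Proof.
move=> mf fi; apply: (@Rintegral_pushforward_lebesgue (fun x => x - h)) => //.
  exact: measurable_funB.
have mphi : measurable_fun setT (fun x : measurableTypeR R =>
  (x - h : measurableTypeR R)).
  exact: measurable_funB.
move=> A mA; apply/esym; pose pm :=
  measure_function_pushforward__canonical__measure_function_Measure mu mphi.
(* Translation invariance: the pushforward is a measure that agrees with Lebesgue measure on
   half-open intervals, hence everywhere. *)
apply: (@lebesgue_measure_unique R pm) => //= _ [[a b]] _ <-.
rewrite /pushforward (_ : _ @^-1` _ = `](a + h), (b + h)]%classic); last first.
  by apply/seteqP; split => x /=; rewrite !in_itv/= ltrBrDr lerBlDr.
rewrite !lebesgue_measure_itv/= !lte_fin ltrD2r.
by case: ifP => // _; rewrite -!EFinB; congr EFin; ring.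
Qed.

Lemma Rintegral_opp (f : R -> R) : measurable_fun setT f ->
  mu.-integrable setT (EFin \o (fun x => f (- x))) ->
  \int[mu]_x f (- x) = \int[mu]_x f x.
Proof.
move=> mf fi; apply: (@Rintegral_pushforward_lebesgue -%R) => //.
exact: lebesgue_measureN.
Qed.

Lemma integrable_bounded_mul_gauss A m (C : R) (f : R -> R) : 0 < A ->
  measurable_fun setT f -> (forall x, `|f x| <= C) ->
  mu.-integrable setT (EFin \o (fun x => f x * gauss A m x)).
Proof.
move=> A0 mf fC; have := integrable_gauss m A0.
move=> /(integrableZl measurableT C); apply: le_integrable => //.
  by apply/measurable_EFinP/measurable_funM => //; exact: measurable_gauss.
move=> x _ /=; rewrite lee_fin !normrM ler_wpM2r//.
by rewrite (le_trans (fC x))// ler_norm.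
Qed.

End GaussFourier.

(** * The characteristic function of a Gaussian, by a differential equation in the frequency *)

Section GaussODE.
Context {R : realType}.
Local Notation mu := (@lebesgue_measure R).

Lemma is_derive_mulr_id (y x : R) : is_derive x (1 : R) (fun w : R => w * y) y.
Proof.
have h : is_derive x (1:R) (y \*: (@id R)) (y *: 1) by exact: is_deriveZ.
rewrite (_ : (fun w => _) = y \*: id); last by apply/funext => w;
  rewrite /= mulrC.
by apply: is_derive_eq h _; rewrite /GRing.scale/= mulr1.
Qed.

Lemma is_derive_cosM (y x : R) : is_derive x (1 : R) (fun w =>
  cos (w * y)) (- sin (x * y) * y).
Proof. exact: (is_derive1_comp (is_derive_cos _) (is_derive_mulr_id y x)). Qed.

Lemma is_derive_subl (y x : R) : is_derive x (1 : R) (fun h : R => y - h) (- 1).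
Proof.
have h : is_derive x (1:R) (cst y - @id R) (0 - 1) by exact: is_deriveB.
by apply: is_derive_eq h _; rewrite sub0r.
Qed.

Lemma is_derive_gauss_shift (A x h : R) :
  is_derive h (1 : R) (fun k => gauss A k x) (2 * A * (x - h) * gauss A h x).
Proof.
have h1 := is_derive_subl x h.
have h2 : is_derive h (1:R) (fun k => - (A * (x - k) ^+ 2)) (2 * A * (x - h)).
  have e := is_deriveZ (- A) (is_deriveX 2 h1).
  rewrite (_ : (fun k => _) = (- A) \*: ((fun k => x - k) ^+ 2)); last first.
    by apply/funext => k; rewrite /= /GRing.scale/= mulNr.
  apply: is_derive_eq e _; rewrite /GRing.scale/= expr1; ring.
have := is_derive1_comp (is_derive_expR _) h2; rewrite mulrC; exact.
Qed.

Lemma is_derive_sin_shift (w x h : R) :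
  is_derive h (1 : R) (fun k => sin (w * (x - k))) (- w * cos (w * (x - h))).
Proof.
have h1 := is_deriveZ w (is_derive_subl x h).
have := is_derive1_comp (is_derive_sin _) h1.
move=> h2; apply: is_derive_eq h2 _; rewrite /GRing.scale/=; ring.
Qed.

(** Half of the exponent absorbs the factor [|y|]: it is at most [1 + y^2], hence at most
    [(1 + 2 / A) * (1 + A / 2 * y^2)], and [1 + t <= exp t]. This supplies the dominating functions
    for differentiation under the integral. *)
Lemma norm_mul_gauss_le (A y : R) : 0 < A ->
  `|y| * gauss A 0 y <= (1 + 2 / A) * gauss (A / 2) 0 y.
Proof.
move=> A0; rewrite /gauss !subr0.
have -> : - (A * y ^+ 2) = - (A / 2 * y ^+ 2) + - (A / 2 * y ^+ 2) by field.
rewrite expRD mulrA ler_wpM2r ?expR_ge0//.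
rewrite expRN -ler_pdivlMr ?invr_gt0 ?expR_gt0// invrK.
have y1 : `|y| <= 1 + y ^+ 2.
  by rewrite -real_normK ?num_real//; have := sqr_ge0 (`|y| - 1); nra.
apply: (le_trans y1); apply: (@le_trans _ _ ((1 + 2 / A) * (1 + A / 2 * y ^+
  2))).
  have -> : (1 + 2 / A) * (1 + A / 2 * y ^+ 2) = 1 + y ^+ 2 + (2 / A + A / 2 *
    y ^+ 2).
    by field; rewrite gt_eqF.
  by rewrite lerDl addr_ge0 ?(mulr_ge0 (divr_ge0 (ltW A0) _) (sqr_ge0 _))
    ?divr_ge0 ?ltW.
by rewrite ler_wpM2l ?expR_ge1Dx// addr_ge0// divr_ge0// ltW.
Qed.

Lemma measurable_sin : measurable_fun setT (@sin R).
Proof. by apply: continuous_measurable_fun; exact: continuous_sin. Qed.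

Lemma measurable_cos : measurable_fun setT (@cos R).
Proof. by apply: continuous_measurable_fun; exact: continuous_cos. Qed.

Lemma norm_sin_le1 (x : R) : `|sin x| <= 1.
Proof. by rewrite ler_norml sin_geN1 sin_le1. Qed.

Lemma norm_cos_le1 (x : R) : `|cos x| <= 1.
Proof. by rewrite ler_norml cos_geN1 cos_le1. Qed.

Let gcos A (w x : R) := cos (w * x) * gauss A 0 x.
Let xgsin A (w x : R) := - sin (w * x) * x * gauss A 0 x.

Lemma is_derive_integral_gcos A w : 0 < A ->
  is_derive w (1 : R) (fun w => \int[mu]_x gcos A w x) (\int[mu]_x xgsin A w x).
Proof.
move=> A0.
have D v y : is_derive v (1:R) (gcos A ^~ y) (xgsin A v y).
  have h := is_deriveZ (gauss A 0 y) (is_derive_cosM y v).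
  rewrite (_ : (fun k => _) = gauss A 0 y \*: (fun w => cos (w * y)));
    last first.
    by apply/funext => k; rewrite /= /GRing.scale/= mulrC.
  by apply: is_derive_eq h _; rewrite /GRing.scale/= mulrC.
have wI : [set` `](w - 1), (w + 1)[ ] w by rewrite /= in_itv/=; apply/andP;
  split; lra.
pose G y := (1 + 2 / A) * gauss (A / 2) 0 y.
have Gge0 y : 0 <= G y by rewrite mulr_ge0 ?gauss_ge0// addr_ge0// divr_ge0//
  ltW.
have iG : mu.-integrable setT (EFin \o G).
  apply: eq_integrable (integrableZl measurableT (1 + 2 / A) (integrable_gauss
    0 (divr_gt0 A0 (ltr0Sn R 1)))) => //.
have hi x : mu.-integrable setT (EFin \o gcos A x).
  apply: (@integrable_bounded_mul_gauss _ A 0 1 (fun y => cos (x * y))) => //.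
    by apply: measurableT_comp; [exact: measurable_cos|exact: measurable_funM].
  by move=> y; exact: norm_cos_le1.
have pE x y : partial1of2 (gcos A) x y = xgsin A x y.
  by rewrite partial1of2E; exact: derive_val.
have GB x y : `|partial1of2 (gcos A) x y| <= G y.
  rewrite pE /xgsin !normrM normrN (ger0_norm (gauss_ge0 _ _ _)) -mulrA.
  apply: le_trans (norm_mul_gauss_le y A0).
  by rewrite ler_piMl ?norm_sin_le1// mulr_ge0// gauss_ge0.
have d1 := @derivable_under_integral R _ _ mu (gcos A) setT measurableT w _ _
  wI (fun x _ => hi x) (fun x y _ _ =>
  @ex_derive _ _ _ _ _ _ _ (D x y)) G Gge0 iG (fun x y _ _ => GB x y).
have d2 := @differentiation_under_integral R _ _ mu (gcos A) setT measurableT w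
  _ _ wI (fun x _ => hi x) (fun x y _ _ =>
  @ex_derive _ _ _ _ _ _ _ (D x y)) G Gge0 iG (fun x y _ _ => GB x y).
apply: DeriveDef => //; rewrite -derive1E d2.
by apply: eq_Rintegral => x _; rewrite pE.
Qed.

(** Sine times Gaussian, both translated by [h]; no hyperbolic function is meant. *)
Let gsinh A (w h x : R) := sin (w * (x - h)) * gauss A h x.

(** The difference of the exponents is [A * (1 - h^2) + A / 2 * (x - 2 * h)^2]. The right-hand side
    does not involve [h], as a dominating function must not. *)
Lemma gauss_shift_le (A x h : R) : 0 < A -> h ^+ 2 <= 1 ->
  gauss A h x <= expR A * gauss (A / 2) 0 x.
Proof.
move=> A0 h1; rewrite /gauss subr0 -expRD ler_expR.
rewrite -subr_ge0.
have -> : A - A / 2 * x ^+ 2 - - (A * (x - h) ^+ 2) =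
  A * (1 - h ^+ 2) + A / 2 * (x - 2 * h) ^+ 2 by field.
have Ale := ltW A0.
by apply: addr_ge0; apply: mulr_ge0 => //;
  rewrite ?subr_ge0 ?sqr_ge0 ?divr_ge0 ?h1.
Qed.

(* The integral of a translated function does not depend on the translation;
   its derivative is the integration by parts that closes the ODE below. *)
Lemma integral_derive_gsin A w : 0 < A ->
  \int[mu]_x (2 * A * x * sin (w * x) * gauss A 0 x - w * gcos A w x) = 0.
Proof.
move=> A0.
pose dg h x := 2 * A * (x - h) * sin (w * (x - h)) * gauss A h x -
  w * cos (w * (x - h)) * gauss A h x.
have D h x : is_derive h (1:R) (gsinh A w ^~ x) (dg h x).
  have e := is_deriveM (is_derive_sin_shift w x h) (is_derive_gauss_shift A x
    h).
  by apply: is_derive_eq e _; rewrite /GRing.scale/= /dg; ring.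
have wI : [set` `](-1 : R), 1[ ] (0 : R) by rewrite /= in_itv/=; apply/andP;
  split; lra.
(* The two summands of [K] bound the two terms of [dg]. In [G] below, the rate is halved twice: once
   to absorb [|x - h|], once to absorb the translation, at the cost of [expR (A / 2)]. *)
pose K := 2 * A * (1 + 2 / A) + `|w|.
have K0 : 0 <= K by rewrite addr_ge0// mulr_ge0 ?addr_ge0 ?divr_ge0 ?mulr_ge0
  ?ltW.
pose G y := K * expR (A / 2) * gauss (A / 2 / 2) 0 y.
have Gge0 y : 0 <= G y.
  exact: mulr_ge0 (mulr_ge0 K0 (expR_ge0 _)) (gauss_ge0 _ _ _).
have iG : mu.-integrable setT (EFin \o G).
  apply: eq_integrable (integrableZl measurableT (K * expR (A / 2))
    (integrable_gauss 0 (divr_gt0 (divr_gt0 A0 (ltr0Sn R 1)) (ltr0Sn R 1)))) =>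
    //.
have mg h : measurable_fun setT (fun y : R => sin (w * (y - h))).
  apply: measurableT_comp; first exact: measurable_sin.
  by apply: measurable_funM => //; exact: measurable_funB.
have hi h : mu.-integrable setT (EFin \o gsinh A w h).
  apply: (@integrable_bounded_mul_gauss _ A h 1 (fun y =>
    sin (w * (y - h)))) => //.
  by move=> y; exact: norm_sin_le1.
have pE x y : partial1of2 (gsinh A w) x y = dg x y.
  by rewrite partial1of2E; exact: derive_val.
have GB h x : [set` `](-1 : R), 1[ ] h -> `|partial1of2 (gsinh A w) h x| <= G x.
  rewrite /= in_itv/= => /andP[h1 h2].
  have hh : h ^+ 2 <= 1 by nra.
  rewrite pE /dg; apply: le_trans (ler_normB _ _) _.
  rewrite !normrM (ger0_norm (gauss_ge0 _ _ _)) (ger0_norm (_ : 0 <= 2))//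
    (ger0_norm (ltW A0)).
  have e1 := norm_mul_gauss_le (x - h) A0.
  have e2 := @gauss_shift_le (A / 2) x h (divr_gt0 A0 (ltr0Sn R 1)) hh.
  have es := norm_sin_le1 (w * (x - h)); have ec := norm_cos_le1 (w * (x - h)).
  have gE B : gauss B 0 (x - h) = gauss B h x by rewrite /gauss subr0.
  rewrite !gE in e1.
  have gle : gauss A h x <= gauss (A / 2) h x.
    rewrite /gauss ler_expR lerN2 ler_wpM2r ?sqr_ge0//; lra.
  have g0 : 0 <= gauss A h x := gauss_ge0 _ _ _.
  have n0 := normr_ge0 (x - h); have w0 := normr_ge0 w.
  apply: (@le_trans _ _ (K * gauss (A / 2) h x)); last first.
    by rewrite /G -mulrA ler_wpM2l.
  rewrite /K [leRHS]mulrDl; apply: lerD.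
    rewrite -[leRHS]mulrA; apply: le_trans (_ : 2 * A * (`|x - h| * gauss A h
      x) <= _).
      rewrite -!(mulrA (2 * A)) ler_wpM2l ?mulr_ge0 ?(ltW A0)//.
      by rewrite mulrAC ler_piMr ?mulr_ge0.
    by rewrite ler_wpM2l ?mulr_ge0 ?(ltW A0).
  rewrite -mulrA ler_wpM2l//; apply: le_trans gle.
  by rewrite ler_piMl.
have d2 := @differentiation_under_integral R _ _ mu (gsinh A w) setT
  measurableT 0 _ _ wI (fun x _ => hi x) (fun x y _ _ =>
  @ex_derive _ _ _ _ _ _ _ (D x y)) G Gge0 iG (fun x y hx _ => GB x y hx).
have cE : (fun h => \int[mu]_x gsinh A w h x) = cst (\int[mu]_x gsinh A w 0 x).
  apply/funext => h /=.
  rewrite -(@Rintegral_shift _ (gsinh A w 0) h).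
  - by apply: eq_Rintegral => x _; rewrite /gsinh /gauss !subr0.
  - by apply: measurable_funM; [exact: mg|exact: measurable_gauss].
  - apply: eq_integrable (hi h) => // x _ /=.
    by rewrite /gsinh /gauss !subr0.
rewrite cE derive1_cst in d2.
rewrite [RHS]d2; apply: eq_Rintegral => x _.
by rewrite pE /dg /gcos !subr0 mulrA.
Qed.

(** Call the left side [F w]. Differentiating under the integral and then integrating by parts gives
    [F' = - (w / (2 * A)) * F], so [F w * exp (w^2 / (4 * A))] has zero derivative and equals its
    value [F 0 = sqrt (pi / A)]. *)
Lemma Rintegral_gauss_cos A w : 0 < A ->
  \int[mu]_x (cos (w * x) * gauss A 0 x) =
  Num.sqrt (pi / A) * expR (- (w ^+ 2 / (4 * A))).
Proof.
move=> A0.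
pose F v := \int[mu]_x gcos A v x.
have mcos v : measurable_fun setT (fun x : R => cos (v * x)).
  by apply: measurableT_comp; [exact: measurable_cos|exact: measurable_funM].
have icos v : mu.-integrable setT (EFin \o gcos A v).
  by apply: (@integrable_bounded_mul_gauss _ A 0 1 (fun y => cos (v * y))) =>
    // y; exact: norm_cos_le1.
have ixs v : mu.-integrable setT (EFin \o xgsin A v).
  have := @integrable_gauss R (A / 2) 0 (divr_gt0 A0 (ltr0Sn R 1)).
  move=> /(integrableZl measurableT (1 + 2 / A)); apply: le_integrable => //.
    apply/measurable_EFinP; apply: measurable_funM;
      last exact: measurable_gauss.
    apply: measurable_funM => //; apply: measurableT_comp => //.
    by apply: measurableT_comp; [exact: measurable_sin|exact: measurable_funM].
  move=> x _ /=; rewrite lee_fin /xgsin !normrM normrN -mulrA.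
  rewrite (ger0_norm (gauss_ge0 A _ _)) -normrM [leRHS]ger0_norm; last first.
    by rewrite mulr_ge0 ?gauss_ge0// addr_ge0// divr_ge0// ltW.
  apply: le_trans (norm_mul_gauss_le x A0).
  by rewrite ler_piMl ?norm_sin_le1// mulr_ge0// gauss_ge0.
have ode v : \int[mu]_x xgsin A v x = - (v / (2 * A)) * F v.
  have := integral_derive_gsin v A0.
  rewrite (_ : (fun x => _) = (fun x =>
    (- (2 * A)) * xgsin A v x - v * gcos A v x)); last first.
    by apply/funext => x; rewrite /xgsin; ring.
  rewrite RintegralB//; [|exact: integrableZl_EFin|exact: integrableZl_EFin].
  rewrite !RintegralZl// -/(F v) => e.
  apply: (@mulfI _ (- (2 * A))); first by rewrite oppr_eq0 gt_eqF ?mulr_gt0.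
  move/eqP: e; rewrite subr_eq0 => /eqP ->; field.
  by rewrite gt_eqF.
pose H v := F v * expR (v ^+ 2 / (4 * A)).
have dH v : is_derive v (1:R) H 0.
  have h1 := is_derive_integral_gcos v A0.
  have h2 : is_derive v (1:R) (fun v => v ^+ 2 / (4 * A)) (2 * v / (4 * A)).
    have e := is_deriveZ (4 * A)^-1 (is_deriveX 2 (is_derive_id v (1:R))).
    rewrite (_ : (fun k => _) = (4 * A)^-1 \*: (@id R ^+ 2)); last first.
      by apply/funext => k; rewrite /= /GRing.scale/= mulrC.
    by apply: is_derive_eq e _; rewrite /GRing.scale/= expr1; field;
      rewrite gt_eqF.
  have e := is_deriveM h1 (is_derive1_comp (is_derive_expR _) h2).
  apply: is_derive_eq e _; rewrite ode /F /GRing.scale/=; field.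
  by rewrite gt_eqF.
have := is_derive_0_is_cst w 0 dH.
rewrite /H expr0n/= mul0r expR0 mulr1 => e.
rewrite -/(gcos A w _) -/(F w) expRN.
have -> : Num.sqrt (pi / A) = F 0.
  rewrite /F -(Rintegral_gauss 0 A0); apply: eq_Rintegral => x _.
  by rewrite /gcos mul0r cos0 mul1r.
by rewrite -e -mulrA divff ?mulr1// gt_eqF ?expR_gt0.
Qed.

(** The integrand is odd, so reflection makes the integral its own opposite. *)
Lemma Rintegral_gauss_sin A w : 0 < A ->
  \int[mu]_x (sin (w * x) * gauss A 0 x) = 0.
Proof.
move=> A0; pose g x := sin (w * x) * gauss A 0 x.
have mg : measurable_fun setT g.
  apply: measurable_funM; last exact: measurable_gauss.
  by apply: measurableT_comp; [exact: measurable_sin|exact: measurable_funM].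
have ig : mu.-integrable setT (EFin \o g).
  apply: (@integrable_bounded_mul_gauss _ A 0 1 (fun y => sin (w * y))) => //.
    by apply: measurableT_comp; [exact: measurable_sin|exact: measurable_funM].
  by move=> y; exact: norm_sin_le1.
have gN x : g (- x) = - 1 * g x.
  by rewrite /g mulrN sinN /gauss !subr0 sqrrN mulN1r mulNr.
have := @Rintegral_opp _ g mg.
rewrite (_ : (fun x => g (- x)) = (fun x => - 1 * g x)); last by apply/funext.
rewrite RintegralZl// => /(_ (integrableZl_EFin _ ig)).
rewrite -/(\int[mu]_x g x) /=; lra.
Qed.

(** Centring at [m] splits off the phase [expi (w * m)]; for the centred Gaussian the real part is
    the cosine integral and the imaginary part vanishes. *)
Lemma cintegral_gauss A m w : 0 < A ->
  cintegral mu (fun x => expi (w * x) * (gauss A m x)%:C) =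
  expi (w * m) * (Num.sqrt (pi / A) * expR (- (w ^+ 2 / (4 * A))))%:C.
Proof.
move=> A0.
have -> : (fun x => expi (w * x) * (gauss A m x)%:C) =
  (fun x => expi (w * m) * (expi (w * (x - m)) * (gauss A 0 (x - m))%:C)).
  apply/funext => x; rewrite mulrA; congr (_ * _); last by rewrite /gauss subr0.
  have {1}-> : w * x = w * m + w * (x - m) by ring.
  rewrite /expi cosD sinD; apply/eqP; rewrite eq_complex/=.
  by apply/andP; split; apply/eqP; ring.
have ms : measurable_fun setT (fun y : R => y - m) by exact: measurable_funB.
have mc : measurable_fun setT (fun x : R => cos (w * x) * gauss A 0 x).
  apply: measurable_funM; last exact: measurable_gauss.
  by apply: measurableT_comp; [exact: measurable_cos|exact: measurable_funM].
have msn : measurable_fun setT (fun x : R => sin (w * x) * gauss A 0 x).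
  apply: measurable_funM; last exact: measurable_gauss.
  by apply: measurableT_comp; [exact: measurable_sin|exact: measurable_funM].
have gE x : gauss A 0 (x - m) = gauss A m x by rewrite /gauss subr0.
rewrite cintegralZl; last first.
  apply: (@cintegrable_wave _ (measurableTypeR R) _ mu (fun x =>
    w * (x - m)) (fun x => gauss A 0 (x - m))).
    exact: measurable_funM.
  by apply: eq_integrable (integrable_gauss m A0) => // x _ /=; rewrite gE.
congr (_ * _); rewrite /cintegral/=.
under eq_Rintegral do rewrite mulr0 subr0.
under [X in _ +i* X]eq_Rintegral do rewrite mulr0 add0r.
rewrite (@Rintegral_shift _ (fun x => cos (w * x) * gauss A 0 x)) //;
  last first.
  have h : mu.-integrable setT (EFin \o (fun x =>
    cos (w * (x - m)) * gauss A m x)).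
    apply: (@integrable_bounded_mul_gauss _ A m 1 (fun x =>
      cos (w * (x - m)))) => //.
      by apply: measurableT_comp;
        [exact: measurable_cos|exact: measurable_funM].
    by move=> y; exact: norm_cos_le1.
  by apply: eq_integrable h => // x _ /=; rewrite gE.
rewrite (@Rintegral_shift _ (fun x => sin (w * x) * gauss A 0 x)) //;
  last first.
  have h : mu.-integrable setT (EFin \o (fun x =>
    sin (w * (x - m)) * gauss A m x)).
    apply: (@integrable_bounded_mul_gauss _ A m 1 (fun x =>
      sin (w * (x - m)))) => //.
      by apply: measurableT_comp;
        [exact: measurable_sin|exact: measurable_funM].
    by move=> y; exact: norm_sin_le1.
  by apply: eq_integrable h => // x _ /=; rewrite gE.
by rewrite Rintegral_gauss_cos// Rintegral_gauss_sin.
Qed.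

End GaussODE.

(** * Superpositions of Gaussians and the powers of A *)

Definition leb1 {R : realType} : {sigma_finite_measure set (measurableTypeR R)
  -> \bar R} :=
  @lebesgue_measure R.
(** Convertible to [leb3], but carrying the sigma-finite structure that Fubini asks for. *)
Definition sleb3 {R : realType} := sfprod (sfprod (@leb1 R) (@leb1 R)) (@leb1
  R).

(* [R] carries two convertible measurable structures under distinct displays;
   [lebesgue_measure] lives on [measurableTypeR R]. *)
Notation mspace R :=
  (measurableTypeR R * measurableTypeR R * measurableTypeR R)%type.
Notation mspacetime R := (mspace R * measurableTypeR R)%type.

Lemma measurable_coords {R : realType} :
  [/\ measurable_fun setT (fun p : mspacetime R => p.1.1.1),
      measurable_fun setT (fun p : mspacetime R => p.1.1.2),
      measurable_fun setT (fun p : mspacetime R => p.1.2) &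
      measurable_fun setT (fun p : mspacetime R => p.2)].
Proof.
split.
- by do 2 apply: measurableT_comp => //.
- by do 2 apply: measurableT_comp => //.
- by apply: measurableT_comp.
- exact: measurable_snd.
Qed.

Section Space.
Context {R : realType}.

Lemma expiD (x y : R) : expi (x + y) = expi x * expi y.
Proof.
rewrite /expi cosD sinD; apply/eqP; rewrite eq_complex/=.
by apply/andP; split; apply/eqP; ring.
Qed.

Lemma cintegrable_mul3 (f1 f2 f3 : R -> R[i]) :
  cintegrable leb1 f1 -> cintegrable leb1 f2 -> cintegrable leb1 f3 ->
  cintegrable sleb3 (fun x : space3 R => f1 x.1.1 * f2 x.1.2 * f3 x.2).
Proof.
move=> i1 i2 i3.
have i12 : cintegrable (sfprod leb1 leb1) (fun z => f1 z.1 * f2 z.2).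
  exact: cintegrable_mul_prod i1 i2.
exact: cintegrable_mul_prod i12 i3.
Qed.

Lemma cintegral_mul3 (f1 f2 f3 : R -> R[i]) :
  cintegrable leb1 f1 -> cintegrable leb1 f2 -> cintegrable leb1 f3 ->
  cintegral leb3 (fun x : space3 R => f1 x.1.1 * f2 x.1.2 * f3 x.2) =
  cintegral leb1 f1 * cintegral leb1 f2 * cintegral leb1 f3.
Proof.
move=> i1 i2 i3.
have i12 : cintegrable (sfprod leb1 leb1) (fun z => f1 z.1 * f2 z.2).
  exact: cintegrable_mul_prod i1 i2.
have e1 := cintegral_mul_prod i1 i2.
have e2 := cintegral_mul_prod i12 i3.
by rewrite -e1 -[RHS]e2.
Qed.

Lemma cintegral_mul4 (f : space3 R -> R[i]) (g : R -> R[i]) :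
  cintegrable sleb3 f -> cintegrable leb1 g ->
  cintegral leb4 (fun z : spacetime R => f z.1 * g z.2) =
  cintegral leb3 f * cintegral leb1 g.
Proof.
move=> fi gi.
have e := cintegral_mul_prod fi gi.
exact: e.
Qed.

Lemma measurable_dot (x : space3 R) : measurable_fun setT (@dot R x).
Proof.
apply: measurable_funD; [apply: measurable_funD|]; apply: measurable_funM => //.
- exact: measurableT_comp.
- exact: measurableT_comp.
Qed.

Lemma dotC (x y : space3 R) : dot x y = dot y x.
Proof. by rewrite /dot; congr (_ + _ + _); rewrite mulrC. Qed.

(** Fourier inversion passes to superpositions: [h] is an integral over [y] of slices [k], each of
    which is inverted explicitly by [l]. Two applications of Fubini exchange the integral in [y]
    with the inverse and with the direct transform; joint integrability of [k] serves the first,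
    that of [l] the second. *)
Lemma fourier3_inv_superposition (k : space3 R -> R -> R)
    (l : space3 R -> R -> R[i]) (h : space3 R -> R) :
  (sleb3 \x leb1)%E.-integrable setT (EFin \o (fun p => k p.1 p.2)) ->
  (forall xi, leb1.-integrable setT (EFin \o k xi)) ->
  (forall y, sleb3.-integrable setT (EFin \o k ^~ y)) ->
  (forall xi, h xi = \int[leb1]_y k xi y) ->
  (forall y x, inv_fourier3 (fun xi => (k xi y)%:C) x = l x y) ->
  cintegrable (sleb3 \x leb1)%E (fun p => l p.1 p.2) ->
  (forall x, cintegrable leb1 (l x)) ->
  (forall y xi, fourier3 (fun x => l x y) xi = (k xi y)%:C) ->
  cintegrable sleb3 (inv_fourier3 (fun xi => (h xi)%:C)) /\
  forall xi, fourier3 (inv_fourier3 (fun xi => (h xi)%:C)) xi = (h xi)%:C.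
Proof.
move=> ik ik1 ik3 hE Hinv il il1 Hfwd.
pose c : R[i] := ((2 * pi) ^- 3)%:C.
have m1 x : measurable_fun setT (fun p : space3 R * R => dot x p.1).
  exact: measurableT_comp (measurable_dot x) _.
have invE x : inv_fourier3 (fun xi => (h xi)%:C) x = cintegral leb1 (l x).
  have iF : cintegrable (sleb3 \x leb1)%E (fun p =>
    c * (expi (dot x p.1) * (k p.1 p.2)%:C)).
    by apply: cintegrableZl; apply: (@cintegrable_wave _ _ _ (sleb3 \x leb1)%E
      _ _ (m1 x) ik).
  have i3 xi : cintegral leb1 (fun y => c * (expi (dot x xi) * (k xi y)%:C)) =
      c * (expi (dot x xi) * (h xi)%:C).
    have i4 := cintegrable_real (ik1 xi).
    rewrite cintegralZl; last exact: cintegrableZl.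
    by rewrite cintegralZl// cintegral_real hE.
  have e := cintegral_prod_swap iF.
  rewrite (cintegral_prod iF) /= in e.
  have ih : cintegrable sleb3 (fun xi => expi (dot x xi) * (h xi)%:C).
    apply: cintegrable_wave; first exact: measurable_dot.
    apply: eq_integrable (integrable_Rintegral ik) => // xi _ /=.
    by rewrite hE.
  rewrite /inv_fourier3 -/c -(cintegralZl c ih).
  transitivity (cintegral sleb3 (fun xi => cintegral leb1 (fun y =>
    c * (expi (dot x xi) * (k xi y)%:C)))).
    by congr cintegral; apply/funext => xi; rewrite i3.
  rewrite e; congr cintegral; apply/funext => y.
  rewrite -Hinv /inv_fourier3 -/c cintegralZl //.
  by apply: cintegrable_wave; [exact: measurable_dot|exact: ik3].
have invE' : inv_fourier3 (fun xi => (h xi)%:C) = (fun x =>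
  cintegral leb1 (l x)).
  by apply/funext.
rewrite invE'; split; first exact: (cintegrable_cintegral il).
move=> xi.
have iF : cintegrable (sleb3 \x leb1)%E (fun p =>
  expi (- dot p.1 xi) * l p.1 p.2).
  apply: cintegrable_expiM => //; apply: measurableT_comp => //.
  by under eq_fun do rewrite dotC; exact: m1.
have e := cintegral_prod_swap iF.
rewrite (cintegral_prod iF) /= in e.
transitivity (cintegral sleb3 (fun x => cintegral leb1 (fun y =>
  expi (- dot x xi) * l x y))).
  by rewrite /fourier3; congr cintegral; apply/funext => x; rewrite cintegralZl.
rewrite e hE -cintegral_real; congr cintegral; apply/funext => y.
by rewrite -Hfwd.
Qed.
End Space.

(** * Heat flow of one-dimensional Gaussians *)

Section Superposition.
Context {R : realType}.
Implicit Types (b m x y xi : R).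

Lemma measurable_inv_gt0 d (T : measurableType d) (f : T -> R) :
  (forall t, 0 < f t) -> measurable_fun setT f ->
  measurable_fun setT (fun t => (f t)^-1).
Proof.
move=> f0 mf; rewrite (_ : (fun t => _) = (fun t => f t `^ (-1))).
  exact: (measurableT_comp (measurable_powR (-1)) mf).
by apply/funext => t; rewrite powR_inv1// ltW.
Qed.

Lemma measurable_sqrt_ge0 d (T : measurableType d) (f : T -> R) :
  (forall t, 0 <= f t) -> measurable_fun setT f ->
  measurable_fun setT (fun t => Num.sqrt (f t)).
Proof.
move=> f0 mf; rewrite (_ : (fun t => _) = (fun t => f t `^ (2^-1))).
  exact: (measurableT_comp (measurable_powR 2^-1) mf).
by apply/funext => t; rewrite powR12_sqrt.
Qed.

(* Completing the square: [y^2 xi^2 + b (xi - m)^2] has leading coefficient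
   [y^2 + b], centre [b m / (y^2 + b)] and minimum [b m^2 y^2 / (y^2 + b)]. *)
Definition heat_rate b y := y ^+ 2 + b.
Definition heat_center b m y := b * m / heat_rate b y.
Definition heat_min b m y := expR (- (b * m ^+ 2 * y ^+ 2 / heat_rate b y)).
Definition heat b m xi y := expR (- (y ^+ 2 * xi ^+ 2)) * gauss b m xi.
(** The inverse Fourier transform of [heat] in one variable is a positive Gaussian times a phase;
    this is the positive factor, and the phase [expi (x * heat_center b m y)] is kept apart. *)
Definition heat_inv b m x y :=
  (2 * pi)^-1 * heat_min b m y * Num.sqrt (pi / heat_rate b y) *
  gauss (4 * heat_rate b y)^-1 0 x.

Lemma heat_rate_gt0 b y : 0 < b -> 0 < heat_rate b y.
Proof. by move=> b0; rewrite ltr_wpDl ?sqr_ge0. Qed.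

Lemma heatE b m xi y : 0 < b ->
  heat b m xi y = heat_min b m y * gauss (heat_rate b y) (heat_center b m y) xi.
Proof.
move=> b0; rewrite /heat /heat_min /gauss -!expRD; congr expR.
rewrite /heat_center /heat_rate; field.
by rewrite gt_eqF// -/(heat_rate b y) heat_rate_gt0.
Qed.

Lemma heat_ge0 b m xi y : 0 <= heat b m xi y.
Proof. by rewrite mulr_ge0 ?expR_ge0. Qed.

Lemma heat_le b m xi y : heat b m xi y <= gauss b m xi.
Proof.
rewrite /heat ler_piMl ?gauss_ge0// -expR0 ler_expR oppr_le0.
exact: mulr_ge0 (sqr_ge0 _) (sqr_ge0 _).
Qed.

Lemma heat_min_le1 b m y : 0 < b -> heat_min b m y <= 1.
Proof.
move=> b0; rewrite -expR0 ler_expR oppr_le0.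
apply: divr_ge0; last exact/ltW/heat_rate_gt0.
exact: mulr_ge0 (mulr_ge0 (ltW b0) (sqr_ge0 _)) (sqr_ge0 _).
Qed.

Lemma heat_inv_ge0 b m x y : 0 <= heat_inv b m x y.
Proof.
by rewrite !mulr_ge0 ?sqrtr_ge0 ?expR_ge0 ?invr_ge0 ?mulr_ge0 ?pi_ge0.
Qed.

(** A bound uniform in [x] and [y], so that at a fixed point of space the weight exp(-y^2) alone
    makes the superposition integrable in [y]. *)
Lemma heat_inv_le b m x y : 0 < b ->
  heat_inv b m x y <= (2 * pi)^-1 * Num.sqrt (pi / b).
Proof.
move=> b0; have r0 := heat_rate_gt0 y b0.
have p0 : 0 <= (2 * pi)^-1 :> R by rewrite invr_ge0 mulr_ge0 ?pi_ge0.
rewrite /heat_inv -[leRHS]mulr1 ler_pM ?gauss_ge0//.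
- by rewrite !mulr_ge0 ?expR_ge0.
- rewrite -mulrA ler_wpM2l//;
  apply: (@le_trans _ _ (1 * Num.sqrt (pi / heat_rate b y))).
    by rewrite ler_wpM2r ?heat_min_le1.
  rewrite mul1r ler_wsqrtr// ler_wpM2l ?pi_ge0// lef_pV2// /heat_rate.
  by rewrite lerDr sqr_ge0.
- rewrite /gauss -expR0 ler_expR oppr_le0 mulr_ge0 ?sqr_ge0// invr_ge0.
  by rewrite mulr_ge0// ltW.
Qed.

(** By [heatE] this is the transform of a single Gaussian. Each axis takes one factor [(2 * pi)^-1],
    which together make up the constant of [inv_fourier3]. *)
Lemma cintegral_heat b m x y : 0 < b ->
  (2 * pi)^-1%:C * cintegral leb1 (fun xi =>
    expi (x * xi) * (heat b m xi y)%:C) =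
  expi (x * heat_center b m y) * (heat_inv b m x y)%:C.
Proof.
move=> b0; have r0 := heat_rate_gt0 y b0.
have ig := @integrable_gauss R (heat_rate b y) (heat_center b m y) r0.
rewrite (_ : (fun xi => _) = (fun xi => (heat_min b m y)%:C *
   (expi (x * xi) * (gauss (heat_rate b y) (heat_center b m y) xi)%:C)));
     last first.
  by apply/funext => xi; rewrite heatE// rmorphM/= mulrCA.
rewrite cintegralZl; last first.
  apply: (@cintegrable_wave _ _ _ leb1 _ _ _ ig); exact: measurable_funM.
rewrite [X in _ * (_ * X)]cintegral_gauss// /heat_inv.
have -> : gauss (4 * heat_rate b y)^-1 0 x = expR (- (x ^+ 2 / (4 * heat_rate b
  y))).
  by rewrite /gauss subr0 mulrC.
by rewrite !rmorphM/=; ring.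
Qed.

(** A Gaussian of rate [b] has mass [sqrt (pi / b)]; its transform has rate [1 / (4 * b)] and mass
    [sqrt (pi * (4 * b))]. That the product is [2 * pi] is exactly what cancels the normalisation of
    the inverse transform. *)
Lemma sqrtr_mul_pi b : 0 < b -> Num.sqrt (pi / b) * Num.sqrt (pi * (4 * b)) = 2
  * pi :> R.
Proof.
move=> b0; rewrite -sqrtrM ?divr_ge0 ?pi_ge0 ?ltW//.
have -> : pi / b * (pi * (4 * b)) = (2 * pi) ^+ 2 :> R by field; rewrite gt_eqF.
by rewrite sqrtr_sqr ger0_norm// mulr_ge0 ?pi_ge0.
Qed.

Lemma integrable_heat_inv b m y : 0 < b ->
  leb1.-integrable setT (EFin \o (fun x => heat_inv b m x y)).
Proof.
move=> b0; apply: integrableZl_EFin; apply: integrable_gauss.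
by rewrite invr_gt0 mulr_gt0 ?heat_rate_gt0.
Qed.

(** As [heat_inv] is nonnegative, this is its L^1 norm in [x]; it stays at most 1 for all [y], by
    [heat_min_le1]. *)
Lemma Rintegral_heat_inv b m y : 0 < b ->
  \int[leb1]_x heat_inv b m x y = heat_min b m y.
Proof.
move=> b0; have r0 := heat_rate_gt0 y b0.
have q0 : 0 < (4 * heat_rate b y)^-1 by rewrite invr_gt0 mulr_gt0.
rewrite RintegralZl//; last exact: integrable_gauss.
rewrite [X in _ * X](Rintegral_gauss 0 q0) invrK -[LHS]mulrA sqrtr_mul_pi//.
by rewrite mulrAC mulVf ?mul1r// gt_eqF// mulr_gt0 ?pi_gt0.
Qed.

Lemma cintegral_heat_inv b m xi y : 0 < b ->
  cintegral leb1 (fun x => expi (- (x * xi)) *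
    (expi (x * heat_center b m y) * (heat_inv b m x y)%:C)) = (heat b m xi
      y)%:C.
Proof.
move=> b0; have r0 := heat_rate_gt0 y b0.
pose A' := (4 * heat_rate b y)^-1.
have q0 : 0 < A' by rewrite invr_gt0 mulr_gt0.
have ig := @integrable_gauss R A' 0 q0.
pose c := (2 * pi)^-1 * heat_min b m y * Num.sqrt (pi / heat_rate b y).
rewrite (_ : (fun x => _) = (fun x => c%:C *
   (expi ((heat_center b m y - xi) * x) * (gauss A' 0 x)%:C))); last first.
  apply/funext => x; rewrite mulrA -expiD /heat_inv -/A' -/c rmorphM/= mulrCA.
  by congr (_ * (expi _ * _)); ring.
rewrite cintegralZl; last first.
  apply: (@cintegrable_wave _ _ _ leb1 _ _ _ ig); exact: measurable_funM.
rewrite [X in _ * X]cintegral_gauss// mulr0 /expi cos0 sin0.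
rewrite (_ : (1 +i* 0) = 1%:C)// -!rmorphM/= mul1r heatE//; congr (_%:C).
rewrite /c /A' invrK.
set s1 := Num.sqrt _; set s2 := Num.sqrt _; set e := expR _.
have -> : (2 * pi)^-1 * heat_min b m y * s1 * (s2 * e) =
  (2 * pi)^-1 * (s1 * s2) * (heat_min b m y * e) by ring.
rewrite sqrtr_mul_pi// mulVf ?mul1r; last by rewrite gt_eqF// mulr_gt0 ?pi_gt0.
congr (_ * _); rewrite /gauss; congr expR; field.
by rewrite gt_eqF.
Qed.

End Superposition.

(** * The inverse square root of the symbol applied to Gaussians *)

Section Multiplier.
Context {R : realType}.
Variables (b1 b2 b3 m1 m2 m3 c : R).
Hypotheses (b1_gt0 : 0 < b1) (b2_gt0 : 0 < b2) (b3_gt0 : 0 < b3).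

Definition gauss3 (xi : space3 R) :=
  gauss b1 m1 xi.1.1 * gauss b2 m2 xi.1.2 * gauss b3 m3 xi.2.

(** The factor [gauss 1 0 y] is the contribution of the constant 1 in the symbol |xi|^2 + 1; the
    three coordinates of |xi|^2 go into the three factors [heat]. *)
Let kk (xi : space3 R) (y : R) := c * gauss 1 0 y *
  (heat b1 m1 xi.1.1 y * heat b2 m2 xi.1.2 y * heat b3 m3 xi.2 y).

Let phase (x : space3 R) (y : R) := x.1.1 * heat_center b1 m1 y +
  x.1.2 * heat_center b2 m2 y + x.2 * heat_center b3 m3 y.

Let rho (x : space3 R) (y : R) := c * gauss 1 0 y *
  (heat_inv b1 m1 x.1.1 y * heat_inv b2 m2 x.1.2 y * heat_inv b3 m3 x.2 y).

Let ll (x : space3 R) (y : R) := expi (phase x y) * (rho x y)%:C.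

Lemma measurable_heat (b m : R) d (T : measurableType d) (f g : T -> R) :
  measurable_fun setT f -> measurable_fun setT g ->
  measurable_fun setT (fun t => heat b m (f t) (g t)).
Proof.
move=> mf mg; apply: measurable_funM; apply: measurableT_comp => //.
  by apply: measurableT_comp => //; apply: measurable_funM;
    apply: measurable_funX.
exact: measurable_gauss.
Qed.

Lemma measurable_heat_center (b m : R) d (T : measurableType d) (g : T -> R) :
  0 < b -> measurable_fun setT g ->
  measurable_fun setT (fun t => heat_center b m (g t)).
Proof.
move=> b0 mg; apply: measurable_funM => //.
apply: measurable_inv_gt0 => [t|]; first exact: heat_rate_gt0.
by apply: measurable_funD => //; apply: measurable_funX.
Qed.

Lemma measurable_heat_inv (b m : R) d (T : measurableType d) (f g : T -> R) :
  0 < b -> measurable_fun setT f -> measurable_fun setT g ->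
  measurable_fun setT (fun t => heat_inv b m (f t) (g t)).
Proof.
move=> b0 mf mg.
have mr : measurable_fun setT (fun t => heat_rate b (g t)).
  by apply: measurable_funD => //; apply: measurable_funX.
have r0 t : 0 < heat_rate b (g t) by exact: heat_rate_gt0.
have mri := measurable_inv_gt0 r0 mr.
rewrite /heat_inv /heat_min /gauss.
apply: measurable_funM; first (apply: measurable_funM;
  first apply: measurable_funM => //).
- apply: measurableT_comp => //; apply: measurableT_comp => //.
  by apply: measurable_funM => //; apply: measurable_funM => //;
    apply: measurable_funX.
- apply: measurable_sqrt_ge0 => [t|]; first by rewrite divr_ge0 ?pi_ge0 ?ltW.
  exact: measurable_funM.
- apply: measurableT_comp => //; apply: measurableT_comp => //.
  apply: measurable_funM; last by apply: measurable_funX;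
    apply: measurable_funB.
  apply: measurable_inv_gt0 => [t|]; first by rewrite mulr_gt0.
  exact: measurable_funM.
Qed.

Lemma integrable_gauss3 : sleb3.-integrable setT (EFin \o gauss3).
Proof.
have i1 := @integrable_gauss R b1 m1 b1_gt0.
have i2 := @integrable_gauss R b2 m2 b2_gt0.
have i3 := @integrable_gauss R b3 m3 b3_gt0.
have i12 : (sfprod leb1 leb1).-integrable setT (EFin \o (fun z =>
  gauss b1 m1 z.1 * gauss b2 m2 z.2)).
  exact: (@integrable_mul_prod _ _ _ _ _ leb1 leb1 _ _ i1 i2).
exact: (@integrable_mul_prod _ _ _ _ _ (sfprod leb1 leb1) leb1 _ _ i12 i3).
Qed.

Lemma gauss3_ge0 xi : 0 <= gauss3 xi.
Proof. exact: mulr_ge0 (mulr_ge0 (gauss_ge0 _ _ _) (gauss_ge0 _ _ _))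
  (gauss_ge0 _ _ _). Qed.

Let kk_le xi y : `|kk xi y| <= `|c * gauss 1 0 y * gauss3 xi|.
Proof.
have h0 b m z := heat_ge0 b m z y; have hl b m z := heat_le b m z y.
rewrite /kk [leLHS]normrM [leRHS]normrM ler_wpM2l//.
rewrite [leLHS]ger0_norm; last by rewrite mulr_ge0// mulr_ge0.
rewrite ger0_norm ?gauss3_ge0//.
by apply: ler_pM => //; [rewrite mulr_ge0|apply: ler_pM].
Qed.

Let measurable_kk : measurable_fun setT (fun p : mspacetime R => kk p.1 p.2).
Proof.
have [c1 c2 c3 c4] := @measurable_coords R.
apply: measurable_funM; first apply: measurable_funM => //.
  by apply: measurableT_comp => //; exact: measurable_gauss.
by apply: measurable_funM; first apply: measurable_funM; apply: measurable_heat.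
Qed.

Let integrable_kk : (sleb3 \x leb1)%E.-integrable setT (EFin \o (fun p =>
  kk p.1 p.2)).
Proof.
have i0 := @integrable_gauss R 1 0 ltr01.
have i4 := @integrable_mul_prod _ _ _ _ _ sleb3 leb1 _ _ integrable_gauss3
  (integrableZl_EFin c i0).
have mE : measurable_fun setT (EFin \o (fun p : mspacetime R => kk p.1 p.2)).
  by apply/measurable_EFinP; exact measurable_kk.
apply: (le_integrable measurableT mE _ i4) => p _.
rewrite lee_fin; apply: le_trans (kk_le _ _) _.
by rewrite mulrC.
Qed.

Let integrable_kk1 xi : leb1.-integrable setT (EFin \o kk xi).
Proof.
have i0 := @integrable_gauss R 1 0 ltr01.
apply: le_integrable (integrableZl_EFin (c * gauss3 xi) i0) => //.
  apply/measurable_EFinP; apply: measurable_funM.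
    by apply: measurable_funM => //; exact: measurable_gauss.
  by apply: measurable_funM; first apply: measurable_funM;
    apply: measurable_heat.
by move=> y _ /=; rewrite lee_fin mulrAC; exact: kk_le.
Qed.

Let integrable_kk3 y : sleb3.-integrable setT (EFin \o kk ^~ y).
Proof.
apply: le_integrable (integrableZl_EFin (c * gauss 1 0 y) integrable_gauss3) =>
  //.
  apply/measurable_EFinP; apply: measurable_funM => //.
  by apply: measurable_funM; first apply: measurable_funM;
    apply: measurable_heat => //; apply: measurableT_comp.
by move=> xi _ /=; rewrite lee_fin; exact: kk_le.
Qed.

Let rho3 (x : space3 R) (y : R) :=
  heat_inv b1 m1 x.1.1 y * heat_inv b2 m2 x.1.2 y * heat_inv b3 m3 x.2 y.

Let integrable_rho3 y : sleb3.-integrable setT (EFin \o rho3 ^~ y).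
Proof.
have i1 := integrable_heat_inv m1 y b1_gt0.
have i2 := integrable_heat_inv m2 y b2_gt0.
have i3 := integrable_heat_inv m3 y b3_gt0.
have i12 : (sfprod leb1 leb1).-integrable setT (EFin \o (fun z =>
  heat_inv b1 m1 z.1 y * heat_inv b2 m2 z.2 y)).
  exact: (@integrable_mul_prod _ _ _ _ _ leb1 leb1 _ _ i1 i2).
exact: (@integrable_mul_prod _ _ _ _ _ (sfprod leb1 leb1) leb1 _ _ i12 i3).
Qed.

Let Rintegral_rho3 y : \int[sleb3]_x rho3 x y =
  heat_min b1 m1 y * heat_min b2 m2 y * heat_min b3 m3 y.
Proof.
have i1 := integrable_heat_inv m1 y b1_gt0.
have i2 := integrable_heat_inv m2 y b2_gt0.
have i3 := integrable_heat_inv m3 y b3_gt0.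
have i12 : (sfprod leb1 leb1).-integrable setT (EFin \o (fun z =>
  heat_inv b1 m1 z.1 y * heat_inv b2 m2 z.2 y)).
  exact: (@integrable_mul_prod _ _ _ _ _ leb1 leb1 _ _ i1 i2).
have e1 := @Rintegral_mul_prod _ _ _ _ _ (sfprod leb1 leb1) leb1 _ _ i12 i3.
have e2 := @Rintegral_mul_prod _ _ _ _ _ leb1 leb1 _ _ i1 i2.
rewrite [LHS]e1 [X in X * _]e2.
by rewrite !Rintegral_heat_inv.
Qed.

Let measurable_rho : measurable_fun setT (fun p : mspacetime R => rho p.1 p.2).
Proof.
have [c1 c2 c3 c4] := @measurable_coords R.
apply: measurable_funM; first apply: measurable_funM => //.
  by apply: measurableT_comp => //; exact: measurable_gauss.
by apply: measurable_funM; first apply: measurable_funM;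
  apply: measurable_heat_inv.
Qed.

(** Since [heat_inv] spreads in [x] as [y] grows, no single integrable function of [x] dominates it
    for all [y]. Tonelli with [x] first avoids this: each slice has L^1 norm at most
    [|c| * gauss 1 0 y]. *)
Let integrable_rho : (sleb3 \x leb1)%E.-integrable setT (EFin \o (fun p =>
  rho p.1 p.2)).
Proof.
have mr : measurable_fun setT (EFin \o (fun p : mspacetime R => rho p.1 p.2)).
  by apply/measurable_EFinP; exact measurable_rho.
apply/(@integrable21ltyP _ _ _ _ _ sleb3 leb1 _ mr) => /=.
have i0 := @integrable_gauss R 1 0 ltr01.
have ci0 := integrableZl_EFin `|c| i0.
have inner y : (\int[sleb3]_x `|(rho x y)%:E| =
   (`|c| * gauss 1 0 y * (heat_min b1 m1 y * heat_min b2 m2 y * heat_min b3 m3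
     y))%:E)%E.
  have r3 (x : space3 R) : 0 <= rho3 x y
    by exact: mulr_ge0 (mulr_ge0 (heat_inv_ge0 _ _ _ _) (heat_inv_ge0 _ _ _ _))
    (heat_inv_ge0 _ _ _ _).
  under eq_integral do rewrite /= /rho -/(rho3 _ _) normrM (ger0_norm (r3 _))
    EFinM.
  rewrite integralZl//; last exact: integrable_rho3.
  rewrite normrM (ger0_norm (gauss_ge0 _ _ _)) [RHS]EFinM -Rintegral_rho3.
  congr (_ * _)%E; rewrite /Rintegral fineK//.
  exact: integrable_fin_num (integrable_rho3 y).
have hm0 b m y : 0 <= heat_min b m y by exact: expR_ge0.
have hm1 b m y : 0 < b -> heat_min b m y <= 1 by exact: heat_min_le1.
have mh b m : 0 < b -> measurable_fun setT (fun y : measurableTypeR R =>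
  heat_min b m y).
  move=> b0; rewrite /heat_min.
  apply: measurableT_comp => //; apply: measurableT_comp => //.
  apply: measurable_funM; first by apply: measurable_funM => //;
    apply: measurable_funX.
  apply: measurable_inv_gt0 => [t|]; first exact: heat_rate_gt0.
  by apply: measurable_funD => //; apply: measurable_funX.
have cg0 y : 0 <= `|c| * gauss 1 0 y
  by exact: mulr_ge0 (normr_ge0 _) (gauss_ge0 _ _ _).
have hm30 y : 0 <= heat_min b1 m1 y * heat_min b2 m2 y * heat_min b3 m3 y.
  by apply: mulr_ge0; [apply: mulr_ge0; exact: hm0|exact: hm0].
have mcg : measurable_fun setT (fun y : measurableTypeR R =>
  `|c| * gauss 1 0 y).
  by apply: measurable_funM => //; exact: measurable_gauss.
move/integrableP: ci0 => [_]; apply: le_lt_trans.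
rewrite (@eq_integral _ _ _ leb1 setT (fun y =>
  (`|c| * gauss 1 0 y * (heat_min b1 m1 y * heat_min b2 m2 y * heat_min b3 m3
  y))%:E)); last by move=> y _; exact: inner.
apply: ge0_le_integral => //.
- by move=> y _; rewrite lee_fin; exact: mulr_ge0.
- apply/measurable_EFinP; apply: measurable_funM; first exact: mcg.
  by apply: measurable_funM; first apply: measurable_funM; apply: mh.
- by apply/measurable_EFinP; apply: measurableT_comp.
- move=> y _ /=; rewrite lee_fin (ger0_norm (cg0 y)) ler_piMr//.
  by rewrite !(mulr_ile1, mulr_ge0, hm0, hm1).
Qed.

Let integrable_rho1 x : leb1.-integrable setT (EFin \o rho x).
Proof.
have i0 := @integrable_gauss R 1 0 ltr01.
pose M b := (2 * pi)^-1 * Num.sqrt (pi / b) : R.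
have hl b m z y : 0 < b -> heat_inv b m z y <= M b by exact: heat_inv_le.
have h0 b m z y : 0 <= heat_inv b m z y by exact: heat_inv_ge0.
have M0 b : 0 < b -> 0 <= M b.
  by rewrite /M mulr_ge0 ?invr_ge0 ?sqrtr_ge0// mulr_ge0 ?pi_ge0.
have mr : measurable_fun setT (EFin \o (fun y : measurableTypeR R => rho x y)).
  apply/measurable_EFinP; apply: measurable_funM.
    by apply: measurable_funM => //; exact: measurable_gauss.
  by apply: measurable_funM; first apply: measurable_funM;
    apply: measurable_heat_inv.
apply: (le_integrable measurableT mr _ (integrableZl_EFin (c * (M b1 * M b2 * M
  b3)) i0)).
move=> y _; rewrite lee_fin /rho [in leRHS]mulrAC [leLHS]normrM [leRHS]normrM
  ler_wpM2l//.
have A0 : 0 <= heat_inv b1 m1 x.1.1 y * heat_inv b2 m2 x.1.2 y * heat_inv b3 m3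
  x.2 y.
  by apply: mulr_ge0; [apply: mulr_ge0; exact: h0|exact: h0].
have B0 : 0 <= M b1 * M b2 * M b3.
  by apply: mulr_ge0; [apply: mulr_ge0; exact: M0|exact: M0].
rewrite (ger0_norm A0) (ger0_norm B0).
apply: ler_pM; [by apply: mulr_ge0; exact: h0|exact: h0| |exact: hl].
by apply: ler_pM; [exact: h0|exact: h0|exact: hl|exact: hl].
Qed.

Let measurable_phase : measurable_fun setT (fun p : mspacetime R =>
  phase p.1 p.2).
Proof.
have [c1 c2 c3 c4] := @measurable_coords R.
by apply: measurable_funD; first apply: measurable_funD;
  (apply: measurable_funM => //; apply: measurable_heat_center).
Qed.

Let cintegrable_ll : cintegrable (sleb3 \x leb1)%E (fun p => ll p.1 p.2).
Proof.
exact: (@cintegrable_wave _ _ _ (sleb3 \x leb1)%E _ _ measurable_phase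
  integrable_rho).
Qed.

Let cintegrable_ll1 x : cintegrable leb1 (ll x).
Proof.
apply: (@cintegrable_wave _ _ _ leb1 _ _ _ (integrable_rho1 x)).
by apply: measurable_funD; first apply: measurable_funD;
  (apply: measurable_funM => //; apply: measurable_heat_center).
Qed.

Let inv_fourier3_kk y x : inv_fourier3 (fun xi => (kk xi y)%:C) x = ll x y.
Proof.
pose f b m z xi := expi (z * xi) * (heat b m xi y)%:C : R[i].
have fi b m z : 0 < b -> cintegrable leb1 (f b m z).
  move=> b0.
  have ih : leb1.-integrable setT (EFin \o (fun xi => heat b m xi y)).
    apply: le_integrable (integrable_gauss m b0) => //.
      by apply/measurable_EFinP; apply: measurable_heat.
    move=> xi _ /=; rewrite lee_fin !ger0_norm ?gauss_ge0 ?heat_ge0//.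
    exact: heat_le.
  by apply: (@cintegrable_wave _ _ _ leb1 _ _ _ ih); exact: measurable_funM.
have f1 := fi _ m1 x.1.1 b1_gt0; have f2 := fi _ m2 x.1.2 b2_gt0.
have f3 := fi _ m3 x.2 b3_gt0.
rewrite /inv_fourier3 (_ : (fun xi => _) = (fun xi => (c * gauss 1 0 y)%:C *
   (f b1 m1 x.1.1 xi.1.1 * f b2 m2 x.1.2 xi.1.2 * f b3 m3 x.2 xi.2)));
     last first.
  by apply/funext => xi; rewrite /f /dot !expiD /kk !rmorphM/=; ring.
rewrite [X in _ * X](cintegralZl _ (cintegrable_mul3 f1 f2 f3)).
rewrite [X in _ * (_ * X)](cintegral_mul3 f1 f2 f3).
rewrite -exprVn rmorphXn/=.
set I1 := cintegral _ _; set I2 := cintegral _ _; set I3 := cintegral _ _.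
have e1 := cintegral_heat m1 x.1.1 y b1_gt0.
have e2 := cintegral_heat m2 x.1.2 y b2_gt0.
have e3 := cintegral_heat m3 x.2 y b3_gt0.
set q := (_^-1)%:C in e1 e2 e3 *.
transitivity ((c * gauss 1 0 y)%:C * (q * I1) * (q * I2) * (q * I3));
  first by ring.
rewrite /I1 /I2 /I3 e1 e2 e3 /ll /phase !expiD /rho !rmorphM/=.
by ring.
Qed.

Let fourier3_ll y xi : fourier3 (fun x => ll x y) xi = (kk xi y)%:C.
Proof.
pose f b m z x := expi (- (x * z)) * (expi (x * heat_center b m y) * (heat_inv
  b m x y)%:C) : R[i].
have fi b m z : 0 < b -> cintegrable leb1 (f b m z).
  move=> b0; apply: cintegrable_expiM; first by apply: measurableT_comp => //;
    exact: measurable_funM.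
  apply: (@cintegrable_wave _ _ _ leb1 _ _ _ (integrable_heat_inv m y b0)).
  exact: measurable_funM.
have f1 := fi _ m1 xi.1.1 b1_gt0; have f2 := fi _ m2 xi.1.2 b2_gt0.
have f3 := fi _ m3 xi.2 b3_gt0.
rewrite /fourier3 (_ : (fun x => _) = (fun x => (c * gauss 1 0 y)%:C *
   (f b1 m1 xi.1.1 x.1.1 * f b2 m2 xi.1.2 x.1.2 * f b3 m3 xi.2 x.2)));
     last first.
  apply/funext => x; rewrite /f /dot !opprD !expiD /ll /phase !expiD /rho
    !rmorphM/=; ring.
rewrite [LHS](cintegralZl _ (cintegrable_mul3 f1 f2 f3)).
rewrite [X in _ * X](cintegral_mul3 f1 f2 f3).
by rewrite !cintegral_heat_inv// /kk !rmorphM.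
Qed.

(* [S^(-1/2)] is the superposition [pi^(-1/2) \int exp(- y^2 S) dy]. *)
Lemma fourier3_inv_gauss3 (h := fun xi =>
    c * Num.sqrt pi * symbolA xi `^ (- 2^-1) * gauss3 xi) :
  cintegrable sleb3 (inv_fourier3 (fun xi => (h xi)%:C)) /\
  forall xi, fourier3 (inv_fourier3 (fun xi => (h xi)%:C)) xi = (h xi)%:C.
Proof.
apply: (fourier3_inv_superposition integrable_kk integrable_kk1 integrable_kk3 _
  inv_fourier3_kk cintegrable_ll cintegrable_ll1 fourier3_ll) => xi.
have SE : symbolA xi = 1 + (xi.1.1 ^+ 2 + xi.1.2 ^+ 2 + xi.2 ^+ 2).
  have d0 : 0 <= dot xi xi by rewrite /dot -!expr2 !addr_ge0 ?sqr_ge0.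
  by rewrite /symbolA /enorm sqr_sqrtr// /dot -!expr2 addrC.
have S0 : 0 < symbolA xi by rewrite SE ltr_pwDl// !addr_ge0 ?sqr_ge0.
(* For fixed [xi] the slices form a Gaussian in [y] whose rate is the symbol [S]; its mass
   [sqrt (pi / S)] produces both the power [- 2^-1] and the factor [Num.sqrt pi] in [h]. *)
rewrite (_ : kk xi = (fun y => c * gauss3 xi * gauss (symbolA xi) 0 y));
  last first.
  apply/funext => y; rewrite /kk /gauss3 /heat.
  have -> : gauss (symbolA xi) 0 y = gauss 1 0 y * (expR (- (y ^+ 2 * xi.1.1 ^+
    2)) *
      expR (- (y ^+ 2 * xi.1.2 ^+ 2)) * expR (- (y ^+ 2 * xi.2 ^+ 2))).
    by rewrite /gauss -!expRD SE; congr expR; ring.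
  ring.
rewrite RintegralZl//; last exact: integrable_gauss.
rewrite [X in _ * X](Rintegral_gauss 0 S0) /h sqrtrM ?pi_ge0// sqrtrV ?ltW//.
by rewrite powRN powR12_sqrt ?ltW//; ring.
Qed.

End Multiplier.

(** * Wave packets, their products and their Fourier transforms *)

Section Wavepacket.
Context {R : realType}.
Implicit Types (a b c k l : R).

Lemma cintegrable_wave_gauss a k : 0 < a ->
  cintegrable leb1 (fun x => expi (k * x) * (gauss a 0 x)%:C).
Proof.
move=> a0; apply: (@cintegrable_wave _ _ _ leb1 _ _ _ (integrable_gauss 0 a0)).
exact: measurable_funM.
Qed.

Lemma cintegrable_fourier_gauss a k (xi : R) : 0 < a ->
  cintegrable leb1 (fun x => expi (- (x * xi)) * (expi (k * x) * (gauss a 0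
    x)%:C)).
Proof.
move=> a0; apply: cintegrable_expiM; last exact: cintegrable_wave_gauss.
by apply: measurableT_comp => //; exact: measurable_funM.
Qed.

Lemma cintegral_fourier_gauss a k (xi : R) : 0 < a ->
  cintegral leb1 (fun x => expi (- (x * xi)) * (expi (k * x) * (gauss a 0
    x)%:C)) =
  (Num.sqrt (pi / a) * gauss (4 * a)^-1 k xi)%:C.
Proof.
move=> a0; under eq_fun do rewrite mulrA -expiD.
rewrite (_ : (fun x => _) = (fun x => expi ((k - xi) * x) * (gauss a 0 x)%:C));
  last first.
  by apply/funext => x; congr (expi _ * _); ring.
rewrite [LHS]cintegral_gauss// mulr0 /expi cos0 sin0 (_ : (1 +i* 0) = 1%:C)//.
rewrite -rmorphM/= mul1r; congr (_ * expR _)%:C; field.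
by rewrite gt_eqF.
Qed.

(* Frequency [(k, 0, 0, l)] and widths [a] along the first axis and [b] along
   the others. *)
Definition wavepacket a b k l (z : spacetime R) : R[i] :=
  expi (k * z.1.1.1 + l * z.2) *
  (gauss a 0 z.1.1.1 * gauss b 0 z.1.1.2 * gauss b 0 z.1.2 * gauss b 0 z.2)%:C.

Definition wave_profile a b k l (zeta : spacetime R) : R :=
  gauss (4 * a)^-1 k zeta.1.1.1 * gauss (4 * b)^-1 0 zeta.1.1.2 *
  gauss (4 * b)^-1 0 zeta.1.2 * gauss (4 * b)^-1 l zeta.2.

Definition wave_mass a b : R := Num.sqrt (pi / a) * Num.sqrt (pi / b) ^+ 3.

(** Conjugation reverses the frequency and Gaussian exponents add, so packets are closed under this
    product. The doubled rates in physical space halve the decay rate on the Fourier side. *)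
Lemma wavepacket_mul_conj a b k l k' l' z :
  wavepacket a b k l z * conjc (wavepacket a b k' l' z) =
  wavepacket (2 * a) (2 * b) (k - k') (l - l') z.
Proof.
have cE t r : conjc (expi t * r%:C) = expi (- t) * r%:C :> R[i].
  rewrite /expi cosN sinN; apply/eqP; rewrite eq_complex/=.
  by apply/andP; split; apply/eqP; ring.
have gE d t : gauss (2 * d) 0 t = gauss d 0 t * gauss d 0 t :> R.
  by rewrite /gauss -expRD; congr expR; ring.
rewrite /wavepacket cE !gE.
have -> : (k - k') * z.1.1.1 + (l - l') * z.2 =
  (k * z.1.1.1 + l * z.2) + - (k' * z.1.1.1 + l' * z.2) by ring.
by rewrite [in RHS]expiD !rmorphM/=; ring.
Qed.

(** The trivial phases [expi (0 * _)] are kept so that all three axes are instances of the same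
    one-dimensional transform. *)
Let f3 a b k (xi x : space3 R) : R[i] := (expi (- (x.1.1 * xi.1.1)) * (expi (k
  * x.1.1) * (gauss a 0 x.1.1)%:C)) *
  (expi (- (x.1.2 * xi.1.2)) * (expi (0 * x.1.2) * (gauss b 0 x.1.2)%:C)) *
  (expi (- (x.2 * xi.2)) * (expi (0 * x.2) * (gauss b 0 x.2)%:C)).

Let expi0 x : expi (0 * x) = 1 :> R[i].
Proof. by rewrite mul0r /expi cos0 sin0. Qed.

Let cintegrable_f3 a b k (xi : space3 R) : 0 < a -> 0 < b ->
  cintegrable sleb3 (f3 a b k xi).
Proof.
move=> a0 b0; have g1 := cintegrable_fourier_gauss k xi.1.1 a0.
have g2 := cintegrable_fourier_gauss 0 xi.1.2 b0.
have g3 := cintegrable_fourier_gauss 0 xi.2 b0.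
exact: (cintegrable_mul3 g1 g2 g3).
Qed.

Let cintegral_f3 a b k (xi : space3 R) : 0 < a -> 0 < b ->
  cintegral leb3 (f3 a b k xi) = (Num.sqrt (pi / a) * Num.sqrt (pi / b) ^+ 2 *
    gauss3 (4 * a)^-1 (4 * b)^-1 (4 * b)^-1 k 0 0 xi)%:C.
Proof.
move=> a0 b0; have g1 := cintegrable_fourier_gauss k xi.1.1 a0.
have g2 := cintegrable_fourier_gauss 0 xi.1.2 b0.
have g3 := cintegrable_fourier_gauss 0 xi.2 b0.
rewrite [LHS](cintegral_mul3 g1 g2 g3) !cintegral_fourier_gauss//.
by rewrite -!rmorphM/= /gauss3; congr (_%:C); ring.
Qed.

Lemma fourier_wavepacket a b k l zeta : 0 < a -> 0 < b ->
  fourier (wavepacket a b k l) zeta =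
  (wave_mass a b * wave_profile a b k l zeta)%:C.
Proof.
move=> a0 b0.
rewrite /fourier (_ : (fun z => _) = (fun z => f3 a b k zeta.1 z.1 *
  (expi (- (z.2 * zeta.2)) * (expi (l * z.2) * (gauss b 0 z.2)%:C))));
    last first.
  apply/funext => z; rewrite /f3 !expi0 /wavepacket /dot !opprD !expiD
    !rmorphM/=.
  ring.
rewrite (cintegral_mul4 (cintegrable_f3 _ _ a0 b0) (cintegrable_fourier_gauss _
  _ b0)).
rewrite cintegral_f3// cintegral_fourier_gauss// -rmorphM/=; congr (_%:C).
by rewrite /wave_mass /wave_profile /gauss3; ring.
Qed.

Lemma symbolA_ge1 (xi : space3 R) : 1 <= symbolA xi.
Proof. by rewrite lerDr sqr_ge0. Qed.

Lemma measurable_enorm d (T : measurableType d) (f : T -> space3 R) :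
  measurable_fun setT (fun t => (f t).1.1) ->
  measurable_fun setT (fun t => (f t).1.2) ->
  measurable_fun setT (fun t => (f t).2) ->
  measurable_fun setT (fun t => enorm (f t)).
Proof.
move=> m1 m2 m3; apply: measurable_sqrt_ge0 => [t|].
  by rewrite /dot -!expr2 !addr_ge0 ?sqr_ge0.
by apply: measurable_funD; first apply: measurable_funD; apply: measurable_funM.
Qed.

Lemma integrable_symbolA_gauss3 a b k c : 0 < a -> 0 < b ->
  sleb3.-integrable setT (EFin \o (fun xi => c * symbolA xi `^ (- 2^-1) *
    gauss3 (4 * a)^-1 (4 * b)^-1 (4 * b)^-1 k 0 0 xi)).
Proof.
move=> a0 b0; have ai : 0 < (4 * a)^-1 by rewrite invr_gt0 mulr_gt0.
have bi : 0 < (4 * b)^-1 by rewrite invr_gt0 mulr_gt0.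
have ig := @integrable_gauss3 R _ _ _ k 0 0 ai bi bi.
set g := gauss3 _ _ _ _ _ _ in ig *.
have mg : measurable_fun setT (g : mspace R -> R).
  by apply/measurable_EFinP; exact (measurable_int _ ig).
have mS : measurable_fun setT (fun xi : mspace R => symbolA xi `^ (- 2^-1)).
  apply: (measurableT_comp (measurable_powR _)); apply: measurable_funD => //.
  apply: measurable_funX; apply: measurable_enorm.
  - by apply: measurableT_comp.
  - by apply: measurableT_comp.
  - exact: measurable_snd.
have S1 (xi : space3 R) : symbolA xi `^ (- 2^-1) <= 1.
  rewrite powRN invf_le1 ?powR_gt0 ?(lt_le_trans _ (symbolA_ge1 _))//.
  by rewrite -[leLHS](powRr0 (symbolA xi)) ler_powR ?symbolA_ge1.
have mE : measurable_fun setT (EFin \o (fun xi : mspace R =>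
  c * symbolA xi `^ (- 2^-1) * g xi)).
  apply/measurable_EFinP; apply: measurable_funM; last exact mg.
  apply: measurable_funM; first exact: measurable_cst.
  exact: mS.
apply: (le_integrable measurableT mE _ (integrableZl_EFin c ig)) => xi _.
rewrite lee_fin mulrAC normrM ler_piMr//.
by rewrite ger0_norm ?powR_ge0.
Qed.

(** [powA] acts in the space variable only, so the time factor of the packet is a constant in both
    spatial integrals and passes through. *)
Lemma powA_wavepacket a b k l z : 0 < a -> 0 < b ->
  powA (- 2^-1) (wavepacket a b k l) z =
  inv_fourier3 (fun xi => (Num.sqrt (pi / a) * Num.sqrt (pi / b) ^+ 2 *
    symbolA xi `^ (- 2^-1) * gauss3 (4 * a)^-1 (4 * b)^-1 (4 * b)^-1 k 0 0
      xi)%:C) z.1 *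
  (expi (l * z.2) * (gauss b 0 z.2)%:C).
Proof.
move=> a0 b0; rewrite /powA.
set g := expi _ * _.
have fE (xi : space3 R) : fourier3 (fun x => wavepacket a b k l (x, z.2)) xi =
   g * (Num.sqrt (pi / a) * Num.sqrt (pi / b) ^+ 2 *
    gauss3 (4 * a)^-1 (4 * b)^-1 (4 * b)^-1 k 0 0 xi)%:C.
  rewrite -cintegral_f3// -(cintegralZl _ (cintegrable_f3 _ _ a0 b0)).
  rewrite /fourier3; congr cintegral; apply/funext => x.
  by rewrite /f3 !expi0 /g /wavepacket /dot !opprD !expiD !rmorphM/=; ring.
rewrite /inv_fourier3 -mulrA; congr (_ * _).
set h := (X in _ = cintegral _ (fun xi => _ * (X xi)%:C) * _).
have ih : cintegrable sleb3 (fun xi => expi (dot z.1 xi) * (h xi)%:C).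
  exact: (@cintegrable_wave _ _ _ sleb3 _ _ (measurable_dot _)
    (integrable_symbolA_gauss3 _ _ a0 b0)).
rewrite mulrC -[RHS](cintegralZl g ih).
congr cintegral; apply/funext => xi; rewrite fE /h !rmorphM/=; ring.
Qed.

Lemma fourier_powA_wavepacket a b k l zeta : 0 < a -> 0 < b ->
  fourier (powA (- 2^-1) (wavepacket a b k l)) zeta =
  (symbolA zeta.1 `^ (- 2^-1) * wave_mass a b * wave_profile a b k l zeta)%:C.
Proof.
move=> a0 b0; have ai : 0 < (4 * a)^-1 by rewrite invr_gt0 mulr_gt0.
have bi : 0 < (4 * b)^-1 by rewrite invr_gt0 mulr_gt0.
(* Division by [Num.sqrt pi] compensates the factor that the Gaussian integral in [y] leaves in
   [fourier3_inv_gauss3]. *)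
pose c := (Num.sqrt (pi / a) * Num.sqrt (pi / b) ^+ 2) / Num.sqrt pi.
have /= := @fourier3_inv_gauss3 R _ _ _ k 0 0 c ai bi bi.
have -> : c * Num.sqrt pi = Num.sqrt (pi / a) * Num.sqrt (pi / b) ^+ 2.
  by rewrite /c divfK// gt_eqF// sqrtr_gt0 pi_gt0.
set K := inv_fourier3 _ => -[iK KE].
have fi := cintegrable_fourier_gauss l zeta.2 b0.
have eK : cintegrable sleb3 (fun x => expi (- dot x zeta.1) * K x).
  apply: cintegrable_expiM => //; apply: measurableT_comp => //.
  by under eq_fun do rewrite dotC; exact: measurable_dot.
rewrite /fourier (_ : (fun z => _) = (fun z =>
  (expi (- dot z.1 zeta.1) * K z.1) *
  (expi (- (z.2 * zeta.2)) * (expi (l * z.2) * (gauss b 0 z.2)%:C))));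
    last first.
  by apply/funext => z; rewrite powA_wavepacket// -/K opprD expiD; ring.
rewrite [LHS](cintegral_mul4 eK fi) cintegral_fourier_gauss//.
have := KE zeta.1; rewrite /fourier3 => ->; rewrite -rmorphM/=; congr (_%:C).
by rewrite /wave_mass /wave_profile /gauss3; ring.
Qed.

End Wavepacket.

(** * Wave packets are Schwartz functions *)

Section Schwartz.
Context {R : realType}.
Local Notation V := (spacetime R).
Variables (a b : R) (c : V).
Hypotheses (a_gt0 : 0 < a) (b_gt0 : 0 < b).

Definition lin (w z : V) : R := w.1.1.1 * z.1.1.1 + w.1.1.2 * z.1.1.2 +
  w.1.2 * z.1.2 + w.2 * z.2.

Let q (z : V) := lin (a * z.1.1.1, b * z.1.1.2, b * z.1.2, b * z.2) z.

(** A class containing the real and imaginary parts of a packet, stable under every directional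
    derivative and made of rapidly decaying functions; no formula for iterated derivatives is then
    needed. Polynomial factors enter one linear form at a time, as differentiating the quadratic
    exponent produces them. *)
Inductive packet : (V -> R) -> Prop :=
| packet_cos : packet (fun z => expR (- q z) * cos (lin c z))
| packet_sin : packet (fun z => expR (- q z) * sin (lin c z))
| packet_lin w f : packet f -> packet (fun z => lin w z * f z)
| packet_add f g : packet f -> packet g -> packet (fun z => f z + g z)
| packet_scale r f : packet f -> packet (fun z => r * f z).

(** A directional derivative only sees the restriction to a line, so one-variable calculus
    suffices. *)
Lemma is_derive_line (f : V -> R) (z v : V) (d : R) :
  is_derive (0 : R) (1 : R) (fun h : R =>
    f (h *: v + z)) d -> is_derive z v f d.
Proof.
have fE : (fun h : R => h^-1 *: ((f \o shift z) (h *: v) - f z)) =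
  (fun h : R => h^-1 *: (((fun h => f (h *: v + z)) \o shift 0) (h *: 1) -
     (fun h => f (h *: v + z)) 0)).
  by apply/funext => h /=; rewrite addr0 scale0r add0r /GRing.scale/= mulr1.
by move=> [h1 h2]; split; rewrite /derivable /derive fE.
Qed.

Lemma lin_line (w z v : V) (h : R) : lin w (h *: v + z) = h * lin w v + lin w z.
Proof. by rewrite /lin /= /GRing.scale/=; ring. Qed.

Lemma is_derive_lin (w z v : V) : is_derive z v (lin w) (lin w v).
Proof.
apply: is_derive_line; under eq_fun do rewrite lin_line.
have := is_deriveD (is_derive_mulr_id (lin w v) 0) (is_derive_cst (lin w z)
  (0:R) (1:R)).
by move=> h; apply: is_derive_eq h _; rewrite addr0.
Qed.

(** [lin (grad v) z] is the derivative of [q] at [z] along [v]. By symmetry of [q] it is written as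
    a linear form in [z], which is what [packet_lin] accepts. *)
Let grad (v : V) : V := (2 * a * v.1.1.1, 2 * b * v.1.1.2, 2 * b * v.1.2,
  2 * b * v.2).

Let is_derive_expq (z v : V) :
  is_derive z v (fun z => expR (- q z)) (- lin (grad v) z * expR (- q z)).
Proof.
apply: is_derive_line.
have qE h : - q (h *: v + z) = - q z + (h * - lin (grad v) z + h ^+ 2 * - q v).
  by rewrite /q /lin /grad /= /GRing.scale/=; ring.
under eq_fun do rewrite qE.
have d1 := is_derive_mulr_id (- lin (grad v) z) (0 : R).
have d2 : is_derive (0:R) (1:R) (fun h : R => h ^+ 2 * - q v) 0.
  have e := is_deriveZ (- q v) (is_deriveX 2 (is_derive_id (0:R) (1:R))).
  rewrite (_ : (fun k => _) = (- q v) \*: (@id R ^+ 2)); last first.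
    by apply/funext => k; rewrite /= /GRing.scale/= mulrC.
  by apply: is_derive_eq e _; rewrite /GRing.scale/= expr1 mulr0 mul0r mulr0.
have d3 := is_deriveD (is_derive_cst (- q z) (0:R) (1:R)) (is_deriveD d1 d2).
have := is_derive1_comp (is_derive_expR _) d3.
move=> h; apply: is_derive_eq h _ => /=.
by rewrite !fctE mul0r expr0n mul0r !addr0 add0r mulrC.
Qed.

Let is_derive_coslin (z v : V) :
  is_derive z v (fun z => cos (lin c z)) (- lin c v * sin (lin c z)).
Proof.
apply: is_derive_line; under eq_fun do rewrite lin_line.
have d := is_deriveD (is_derive_mulr_id (lin c v) 0) (is_derive_cst (lin c z)
  (0:R) (1:R)).
have h := is_derive1_comp (is_derive_cos _) d.
by apply: is_derive_eq h _; rewrite !fctE mul0r add0r addr0; ring.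
Qed.

Let is_derive_sinlin (z v : V) :
  is_derive z v (fun z => sin (lin c z)) (lin c v * cos (lin c z)).
Proof.
apply: is_derive_line; under eq_fun do rewrite lin_line.
have d := is_deriveD (is_derive_mulr_id (lin c v) 0) (is_derive_cst (lin c z)
  (0:R) (1:R)).
have h := is_derive1_comp (is_derive_sin _) d.
by apply: is_derive_eq h _; rewrite !fctE mul0r add0r addr0; ring.
Qed.

Lemma packet_derive (v : V) f : packet f ->
  exists2 g, packet g & forall z, is_derive z v f (g z).
Proof.
elim=> [||w h hp [g gp hg]|h k hp [g gp hg] kp [l lp hl]|r h hp [g gp hg]].
- exists (fun z => -1 * (lin (grad v) z * (expR (- q z) * cos (lin c z))) +
     (- lin c v) * (expR (- q z) * sin (lin c z))).
    by do ?constructor.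
  move=> z; have e := is_deriveM (is_derive_expq z v) (is_derive_coslin z v).
  by apply: is_derive_eq e _; rewrite /GRing.scale/=; ring.
- exists (fun z => -1 * (lin (grad v) z * (expR (- q z) * sin (lin c z))) +
     lin c v * (expR (- q z) * cos (lin c z))).
    by do ?constructor.
  move=> z; have e := is_deriveM (is_derive_expq z v) (is_derive_sinlin z v).
  by apply: is_derive_eq e _; rewrite /GRing.scale/=; ring.
- exists (fun z => lin w z * g z + lin w v * h z).
    by do ?constructor.
  move=> z; have e := is_deriveM (is_derive_lin w z v) (hg z).
  by apply: is_derive_eq e _; rewrite /GRing.scale/=; ring.
- exists (fun z => g z + l z); first by constructor.
  by move=> z; exact: is_deriveD (hg z) (hl z).
- exists (fun z => r * g z); first by constructor.
  by move=> z; exact: (is_deriveZ r (hg z)).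
Qed.

Lemma packet_iter_derive (vs : seq V) f : packet f -> packet (iter_derive vs f).
Proof.
elim: vs => //= v vs IH /IH /(packet_derive v)[g gp hg].
rewrite (_ : (fun x => _) = g)//; apply/funext => z.
exact: derive_val.
Qed.

Lemma norm_coord_le (z : V) : [/\ `|z.1.1.1| <= `|z|, `|z.1.1.2| <= `|z|,
  `|z.1.2| <= `|z| & `|z.2| <= `|z|].
Proof.
case: z => [[[z1 z2] z3] z4]; rewrite !prod_normE /=.
by split; rewrite !le_max lexx ?orbT.
Qed.

Lemma norm_sqr_le (z : V) :
  `|z| ^+ 2 <= z.1.1.1 ^+ 2 + z.1.1.2 ^+ 2 + z.1.2 ^+ 2 + z.2 ^+ 2.
Proof.
have mx (x y : R) : Num.max x y ^+ 2 <= x ^+ 2 + y ^+ 2.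
  by case: (leP x y) => _; rewrite ?lerDl ?lerDr sqr_ge0.
have nK (x : R) : `|x| ^+ 2 = x ^+ 2 by rewrite real_normK ?num_real.
case: z => [[[z1 z2] z3] z4]; rewrite !prod_normE /=.
rewrite -(nK z1) -(nK z2) -(nK z3) -(nK z4).
do 3 apply: le_trans (mx _ _) (lerD _ (lexx _)).
exact: lexx.
Qed.

(** Induction with all [N] at once: a linear factor costs one power of [1 + |z|], so its case calls
    the hypothesis at [N.+1]. *)
Lemma packet_decay f : packet f -> forall N, exists C, forall z : V,
  (1 + `|z|) ^+ N * `|f z| <= C.
Proof.
pose m := Num.min a b.
have m0 : 0 < m by rewrite lt_min a_gt0.
(* From [(1 + r)^N <= exp (N * r)] and [q z >= m * r^2] with [r = |z|]; the constant is the maximum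
   of [N * r - m * r^2] over real [r]. *)
have base N (z : V) t : `|t| <= 1 ->
    (1 + `|z|) ^+ N * `|expR (- q z) * t| <= expR (N%:R ^+ 2 / (4 * m)).
  move=> t1; rewrite normrM (ger0_norm (expR_ge0 _)).
  apply: (@le_trans _ _ (expR (N%:R * `|z|) * expR (- q z))).
    apply: ler_pM; rewrite ?exprn_ge0 ?mulr_ge0 ?expR_ge0 ?addr_ge0//.
      by rewrite mulrC expRM_natr lerXn2r ?nnegrE ?expR_ge0 ?addr_ge0//
        expR_ge1Dx.
    by rewrite ler_piMr ?expR_ge0.
  rewrite -expRD ler_expR.
  have hq : m * `|z| ^+ 2 <= q z.
    apply: (@le_trans _ _ (m * (z.1.1.1 ^+ 2 + z.1.1.2 ^+ 2 + z.1.2 ^+ 2 + z.2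
      ^+ 2))).
      by rewrite ler_wpM2l ?norm_sqr_le// ltW.
    have ma : m <= a by rewrite ge_min lexx.
    have mb : m <= b by rewrite ge_min lexx orbT.
    rewrite /q /lin /= !mulrDr -!mulrA -!expr2.
    by rewrite !lerD// ler_wpM2r ?sqr_ge0.
  have e : N%:R ^+ 2 / (4 * m) - N%:R * `|z| + m * `|z| ^+ 2 =
     m * (`|z| - N%:R / (2 * m)) ^+ 2 by field; rewrite gt_eqF.
  have : 0 <= m * (`|z| - N%:R / (2 * m)) ^+ 2
    by rewrite mulr_ge0 ?sqr_ge0 ?ltW.
  rewrite -e; lra.
elim=> [||w h hp IH|h k hp IHh kp IHk|r h hp IH] N.
- by exists (expR (N%:R ^+ 2 / (4 * m))) => z; apply: base; exact: norm_cos_le1.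
- by exists (expR (N%:R ^+ 2 / (4 * m))) => z; apply: base; exact: norm_sin_le1.
- have [C hC] := IH N.+1.
  pose W := `|w.1.1.1| + `|w.1.1.2| + `|w.1.2| + `|w.2|.
  have W0 : 0 <= W by rewrite !addr_ge0.
  exists (W * C) => z.
  have lw : `|lin w z| <= W * (1 + `|z|).
    have [h1 h2 h3 h4] := norm_coord_le z.
    apply: (@le_trans _ _ (W * `|z|)); last by rewrite ler_wpM2l// lerDr.
    rewrite /lin /W !mulrDl; apply: le_trans (ler_normD _ _) _.
    apply: lerD; last by rewrite normrM ler_wpM2l.
    apply: le_trans (ler_normD _ _) _.
    apply: lerD; last by rewrite normrM ler_wpM2l.
    apply: le_trans (ler_normD _ _) _.
    by apply: lerD; rewrite normrM ler_wpM2l.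
  apply: (@le_trans _ _ (W * ((1 + `|z|) ^+ N.+1 * `|h z|)));
    last by rewrite ler_wpM2l.
  have -> : W * ((1 + `|z|) ^+ N.+1 * `|h z|) = (1 + `|z|) ^+ N * (W * (1 +
    `|z|) * `|h z|).
    by rewrite exprS; ring.
  rewrite ler_wpM2l ?exprn_ge0 ?addr_ge0// normrM ler_wpM2r//.
- have [C1 h1] := IHh N; have [C2 h2] := IHk N.
  exists (C1 + C2) => z; apply: le_trans (lerD (h1 z) (h2 z)).
  by rewrite -mulrDr ler_wpM2l ?exprn_ge0 ?addr_ge0 ?ler_normD.
- have [C hC] := IH N; exists (`|r| * C) => z.
  by rewrite normrM mulrCA ler_wpM2l.
Qed.

Lemma packet_schwartz f : packet f -> schwartz_real f.
Proof.
move=> fp vs; have ip := packet_iter_derive vs fp; split;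
  last exact: packet_decay.
move=> z v; have [g _ hg] := packet_derive v ip.
exact: (@ex_derive _ _ _ _ _ _ _ (hg z)).
Qed.

End Schwartz.

Lemma schwartz_wavepacket {R : realType} (a b k l : R) : 0 < a -> 0 < b ->
  schwartz (wavepacket a b k l).
Proof.
move=> a0 b0; split.
- apply: (packet_schwartz (a := a) (b := b) (c := (k, 0, 0, l))) => //.
  rewrite (_ : (fun z => _) = (fun z =>
    expR (- lin (a * z.1.1.1, b * z.1.1.2, b * z.1.2,
    b * z.2) z) * cos (lin (k, 0, 0, l) z))); last first.
    apply/funext => z; rewrite /wavepacket /= /gauss -!expRD mulr0 subr0 mulrC.
    by congr (expR _ * cos _); rewrite /lin/=; ring.
  exact: packet_cos.
- apply: (packet_schwartz (a := a) (b := b) (c := (k, 0, 0, l))) => //.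
  rewrite (_ : (fun z => _) = (fun z =>
    expR (- lin (a * z.1.1.1, b * z.1.1.2, b * z.1.2,
    b * z.2) z) * sin (lin (k, 0, 0, l) z))); last first.
    apply/funext => z; rewrite /wavepacket /= /gauss -!expRD mulr0 add0r mulrC.
    by congr (expR _ * sin _); rewrite /lin/=; ring.
  exact: packet_sin.
Qed.

(** * Norms of wave packets *)

Section Weights.
Context {R : realType}.

(** The exponent may have either sign: [x <= y * t] serves [s >= 0] and [y <= x * t] serves
    [s < 0]. *)
Lemma powR_comparable (x y t s : R) : 0 < x -> 0 < y -> 0 < t ->
  x <= y * t -> y <= x * t -> x `^ s <= y `^ s * t `^ `|s|.
Proof.
move=> x0 y0 t0 xy yx; have [s0|s0] := leP 0 s.
  rewrite ger0_norm// -powRM ?(ltW y0) ?(ltW t0)//.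
  by apply: ge0_ler_powR; rewrite ?nnegrE ?mulr_ge0 ?(ltW x0) ?(ltW y0) ?(ltW
    t0).
rewrite ltr0_norm// -{1 2}(opprK s) !(powRN _ (- s)).
rewrite ler_pdivlMl ?powR_gt0// ler_pdivrMr ?powR_gt0//.
have ns0 : 0 <= - s by rewrite oppr_ge0 ltW.
rewrite mulrC -powRM ?(ltW x0) ?(ltW t0)//.
by apply: ge0_ler_powR; rewrite ?nnegrE ?mulr_ge0 ?(ltW x0) ?(ltW y0) ?(ltW t0).
Qed.

Lemma powR_le_expR (A p eps : R) : 0 < A -> 0 <= p -> 0 < eps ->
  exists2 C : R, 0 < C & forall t,
    0 <= t -> (A * (1 + t)) `^ p <= C * expR (eps * t).
Proof.
(* Raising [u <= K * exp (u / K)] to the power [p] gives the rate [p / K], which this [K] keeps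
   below [eps]; [p + 1] instead of [p] keeps [K] positive when [p = 0]. *)
move=> A0 p0 e0; pose K := (p + 1) / eps.
have K0 : 0 < K by rewrite divr_gt0// ltr_wpDl.
exists (A `^ p * K `^ p * expR (p / K)).
  by rewrite !mulr_gt0 ?powR_gt0 ?expR_gt0.
move=> t t0; have t1 : 0 <= 1 + t by rewrite addr_ge0.
rewrite powRM ?(ltW A0)// -!mulrA ler_wpM2l ?powR_ge0// -expRD.
apply: (@le_trans _ _ ((K * expR ((1 + t) / K)) `^ p)).
  apply: ge0_ler_powR; rewrite ?nnegrE ?(mulr_ge0 (ltW K0) (expR_ge0 _))//.
  rewrite -ler_pdivrMl// mulrC; apply: le_trans (expR_ge1Dx _).
  by rewrite lerDr.
rewrite powRM ?expR_ge0 ?(ltW K0)// ler_wpM2l ?powR_ge0//.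
rewrite -expRM ler_expR.
have -> : (1 + t) / K * p = p / K + p / K * t by ring.
rewrite lerD2l ler_wpM2r// /K ler_pdivrMr// mulrC divfK ?gt_eqF//.
by rewrite lerDl.
Qed.

Lemma jap_ge1 (y : R) : 1 <= jap y.
Proof. by rewrite -[leLHS]sqrtr1 ler_wsqrtr// lerDl sqr_ge0. Qed.

Lemma jap_gt0 (y : R) : 0 < jap y.
Proof. exact: lt_le_trans (jap_ge1 y). Qed.

Lemma jap_sqr (y : R) : jap y ^+ 2 = 1 + y ^+ 2.
Proof. by rewrite sqr_sqrtr// addr_ge0 ?sqr_ge0. Qed.

Lemma jap_le (y t : R) : 0 <= t -> 1 + y ^+ 2 <= t ^+ 2 -> jap y <= t.
Proof. by move=> t0 h; rewrite -(ger0_norm t0) -sqrtr_sqr ler_wsqrtr. Qed.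

Lemma jap_comparable (x y t : R) : 0 <= t -> 1 + x ^+ 2 <= (1 + y ^+ 2) * t ^+
  2 ->
  jap x <= jap y * t.
Proof.
move=> t0 h; apply: jap_le; first by rewrite mulr_ge0 ?(ltW (jap_gt0 y)).
by rewrite exprMn jap_sqr.
Qed.

(** Squared distance to the centre (k, 0, 0, l) in the anisotropic metric in which the packet has
    unit size. All weights are compared with powers of 1 plus this quantity. *)
Definition deviation (N k l : R) (zeta : spacetime R) : R :=
  (N * (zeta.1.1.1 - k)) ^+ 2 + zeta.1.1.2 ^+ 2 + zeta.1.2 ^+ 2 + (zeta.2 - l)
    ^+ 2.

Lemma deviation_ge0 N k l zeta : 0 <= deviation N k l zeta.
Proof. by rewrite !addr_ge0 ?sqr_ge0. Qed.

Lemma enorm_sqr (x : space3 R) : enorm x ^+ 2 = x.1.1 ^+ 2 + x.1.2 ^+ 2 + x.2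
  ^+ 2.
Proof. by rewrite sqr_sqrtr /dot -!expr2// !addr_ge0 ?sqr_ge0. Qed.

Lemma sqr_le_scaled (N y : R) : 1 <= N -> y ^+ 2 <= (N * y) ^+ 2.
Proof.
move=> N1; rewrite exprMn ler_peMl ?sqr_ge0//.
by rewrite -[leLHS](expr1n _ 2) lerXn2r ?nnegrE// (le_trans _ N1).
Qed.

(** A form of Peetre's inequality: <xi> and <k> differ by at most a factor controlled by the
    distance of xi from (k, 0, 0), which [deviation] dominates since [N >= 1]. *)
Lemma jap_enorm_comparable (N k l : R) (zeta : spacetime R) : 1 <= N ->
  jap (enorm zeta.1) <= jap k * (2 * (1 + deviation N k l zeta)) /\
  jap k <= jap (enorm zeta.1) * (2 * (1 + deviation N k l zeta)).
Proof.
move=> N1; have h1 := sqr_le_scaled (zeta.1.1.1 - k) N1.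
have D0 := deviation_ge0 N k l zeta.
set D := deviation _ _ _ _ in D0 *.
have hD : (zeta.1.1.1 - k) ^+ 2 + zeta.1.1.2 ^+ 2 + zeta.1.2 ^+ 2 <= D.
  rewrite /D /deviation; have := sqr_ge0 (zeta.2 - l); lra.
have s2 := sqr_ge0 zeta.1.1.2; have s3 := sqr_ge0 zeta.1.2.
have s1 := sqr_ge0 (zeta.1.1.1 - k).
have key (x y : R) : 0 <= x -> 0 <= y -> y <= 2 * x + 2 * D ->
    1 + y <= (1 + x) * (2 * (1 + D)) ^+ 2.
  move=> x0 y0 yx; apply: (@le_trans _ _ ((1 + x) * (2 * (1 + D)))).
    by have := mulr_ge0 x0 D0; lra.
  rewrite ler_wpM2l ?addr_ge0// expr2 ler_peMl; lra.
have t0 : 0 <= 2 * (1 + D) by lra.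
split; apply: (jap_comparable t0); apply: key; rewrite ?sqr_ge0//.
(* With [x = zeta.1.1.1], the square [(x - 2 * k)^2] equals [2 * k^2 + 2 * (x - k)^2 - x^2]; the
   next line exchanges [x] and [k]. *)
- rewrite enorm_sqr; have := sqr_ge0 (zeta.1.1.1 - 2 * k); lra.
- rewrite enorm_sqr; have := sqr_ge0 (2 * zeta.1.1.1 - k); lra.
Qed.

Lemma norm_le_sqr1 (y : R) : 2 * `|y| <= 1 + y ^+ 2.
Proof. by rewrite -(real_normK (num_real y)); have := sqr_ge0 (`|y| - 1);
  nra. Qed.

(** Expanding about the centre, which lies on the paraboloid, leaves (tau + k^2) + 2k(xi_1 - k) +
    |xi - (k, 0, 0)|^2. The middle term is where the width 1/N is used: as [|k| <= N], it is at most
    2 |N (xi_1 - k)|. *)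
Lemma jap_phase_le (N k : R) (zeta : spacetime R) : 1 <= N -> `|k| <= N ->
  jap (zeta.2 + enorm zeta.1 ^+ 2) <= 4 * (1 + deviation N k (- k ^+ 2) zeta).
Proof.
move=> N1 kN; set D := deviation _ _ _ _.
have D0 : 0 <= D by exact: deviation_ge0.
suff h : `|zeta.2 + enorm zeta.1 ^+ 2| <= 3 * (1 + D).
  apply: jap_le; first by lra.
  by rewrite -(real_normK (num_real (_ + _)));
    have := normr_ge0 (zeta.2 + enorm zeta.1 ^+ 2); nra.
rewrite enorm_sqr.
have -> : zeta.2 + (zeta.1.1.1 ^+ 2 + zeta.1.1.2 ^+ 2 + zeta.1.2 ^+ 2) =
   (zeta.2 - - k ^+ 2) + 2 * k * (zeta.1.1.1 - k) +
   ((zeta.1.1.1 - k) ^+ 2 + zeta.1.1.2 ^+ 2 + zeta.1.2 ^+ 2) by ring.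
have h1 := sqr_le_scaled (zeta.1.1.1 - k) N1.
have s1 := sqr_ge0 (zeta.1.1.1 - k).
have s2 := sqr_ge0 zeta.1.1.2; have s3 := sqr_ge0 zeta.1.2.
have h2 := norm_le_sqr1 (zeta.2 - - k ^+ 2).
have h3 := norm_le_sqr1 (N * (zeta.1.1.1 - k)).
have h4 : `|2 * k * (zeta.1.1.1 - k)| <= 2 * `|N * (zeta.1.1.1 - k)|.
  rewrite !normrM (ger0_norm (_ : 0 <= 2))// -mulrA ler_wpM2l//.
  by rewrite ler_wpM2r// (le_trans kN)// ler_norm.
apply: le_trans (ler_normD _ _) _; rewrite [X in _ + X]ger0_norm;
  last by rewrite !addr_ge0.
have := ler_normD (zeta.2 - - k ^+ 2) (2 * k * (zeta.1.1.1 - k)).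
rewrite /D /deviation in D0 *.
have s4 := sqr_ge0 (zeta.2 - - k ^+ 2).
lra.
Qed.

(** The centre lies on the light cone because [0 <= m] is the length of (m, 0, 0), and xi -> |xi| is
    1-Lipschitz, so no power of N is lost. *)
Lemma jap_cone_le (N m : R) (e : bool) (zeta : spacetime R) : 1 <= N -> 0 <= m
  ->
  jap (zeta.2 + (-1) ^+ e * enorm zeta.1) <=
  4 * (1 + deviation N m (- ((-1) ^+ e * m)) zeta).
Proof.
move=> N1 m0; set D := deviation _ _ _ _.
have D0 : 0 <= D by exact: deviation_ge0.
suff h : `|zeta.2 + (-1) ^+ e * enorm zeta.1| <= 3 * (1 + D).
  apply: jap_le; first by lra.
  by rewrite -(real_normK (num_real (_ + _)));
    have := normr_ge0 (zeta.2 + (-1) ^+ e * enorm zeta.1); nra.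
have -> : zeta.2 + (-1) ^+ e * enorm zeta.1 =
   (zeta.2 - - ((-1) ^+ e * m)) + (-1) ^+ e * (enorm zeta.1 - m) by ring.
have h1 := sqr_le_scaled (zeta.1.1.1 - m) N1.
have s2 := sqr_ge0 zeta.1.1.2; have s3 := sqr_ge0 zeta.1.2.
have h2 := norm_le_sqr1 (zeta.2 - - ((-1) ^+ e * m)).
have h3 := norm_le_sqr1 (enorm zeta.1 - m).
have e0 : 0 <= enorm zeta.1 by exact: sqrtr_ge0.
have le1 : zeta.1.1.1 <= enorm zeta.1.
  rewrite (le_trans (ler_norm _))// -sqrtr_sqr ler_wsqrtr// /dot -!expr2.
  by rewrite -addrA lerDl addr_ge0.
(* The reverse triangle inequality, obtained from m xi_1 <= m |xi|. *)
have h4 : (enorm zeta.1 - m) ^+ 2 <=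
    (zeta.1.1.1 - m) ^+ 2 + zeta.1.1.2 ^+ 2 + zeta.1.2 ^+ 2.
  have -> : (enorm zeta.1 - m) ^+ 2 = enorm zeta.1 ^+ 2 - 2 * (m * enorm
    zeta.1) + m ^+ 2 by ring.
  rewrite enorm_sqr; have := ler_wpM2l m0 le1; nra.
apply: le_trans (ler_normD _ _) _;
  rewrite [X in _ + X]normrM normrX normrN1 expr1n mul1r.
rewrite /D /deviation in D0 *.
have s4 := sqr_ge0 (zeta.2 - - ((-1) ^+ e * m)).
lra.
Qed.
End Weights.

Section Norms.
Context {R : realType}.
Local Notation mV := (mspacetime R).

Definition gauss4 (A N k l : R) (zeta : spacetime R) : R :=
  expR (- (A * deviation N k l zeta)).

Lemma gauss4E A N k l zeta : gauss4 A N k l zeta =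
  gauss (A * N ^+ 2) k zeta.1.1.1 * gauss A 0 zeta.1.1.2 * gauss A 0 zeta.1.2 *
  gauss A l zeta.2.
Proof.
by rewrite /gauss4 /gauss /deviation -!expRD; congr expR; ring.
Qed.

Lemma integrable_gauss4 A N k l : 0 < A -> 0 < N ->
  (sleb3 \x leb1)%E.-integrable setT (EFin \o gauss4 A N k l).
Proof.
move=> A0 N0; have AN : 0 < A * N ^+ 2 by rewrite mulr_gt0 ?exprn_gt0.
have i3 := @integrable_gauss3 R _ _ _ k 0 0 AN A0 A0.
have := @integrable_mul_prod _ _ _ _ _ sleb3 leb1 _ _ i3 (integrable_gauss l
  A0).
by apply: eq_integrable => // z _ /=; rewrite gauss4E.
Qed.

Lemma integral_gauss4 A N k l : 0 < A -> 0 < N ->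
  (\int[leb4]_zeta (gauss4 A N k l zeta)%:E = ((pi / A) ^+ 2 / N)%:E)%E.
Proof.
move=> A0 N0; have AN : 0 < A * N ^+ 2 by rewrite mulr_gt0 ?exprn_gt0.
have i1 := @integrable_gauss R _ k AN.
have i0 := @integrable_gauss R _ 0 A0.
have il := @integrable_gauss R _ l A0.
have i12 : (sfprod leb1 leb1).-integrable setT (EFin \o (fun z =>
  gauss (A * N ^+ 2) k z.1 * gauss A 0 z.2)).
  exact: (@integrable_mul_prod _ _ _ _ _ leb1 leb1 _ _ i1 i0).
have i3 := @integrable_gauss3 R _ _ _ k 0 0 AN A0 A0.
have e1 := @Rintegral_mul_prod _ _ _ _ _ leb1 leb1 _ _ i1 i0.
have e2 := @Rintegral_mul_prod _ _ _ _ _ (sfprod leb1 leb1) leb1 _ _ i12 i0.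
have e3 := @Rintegral_mul_prod _ _ _ _ _ sleb3 leb1 _ _ i3 il.
transitivity ((\int[(sleb3 \x leb1)%E]_zeta gauss4 A N k l zeta)%:E).
  rewrite /Rintegral fineK//.
  exact: integrable_fin_num (integrable_gauss4 k l A0 N0).
congr EFin; rewrite (_ : gauss4 A N k l = (fun z =>
  gauss3 (A * N ^+ 2) A A k 0 0 z.1 * gauss A l z.2)); last first.
  by apply/funext => z; rewrite gauss4E.
rewrite [LHS]e3 [X in X * _]e2 [X in X * _ * _]e1 !Rintegral_gauss//.
have -> : pi / (A * N ^+ 2) = pi / A / N ^+ 2 :> R.
  by field; rewrite !gt_eqF.
have pA : 0 <= pi / A :> R by rewrite divr_ge0 ?pi_ge0 ?ltW.
rewrite (sqrtrM _ pA) sqrtrV ?sqr_ge0// sqrtr_sqr ger0_norm ?ltW//.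
set s := Num.sqrt (pi / A).
have -> : pi / A = s ^+ 2 :> R by rewrite sqr_sqrtr.
by field; rewrite gt_eqF.
Qed.

Lemma Lnorm2_le (f g : mV -> R) : measurable_fun setT f -> measurable_fun setT
  g ->
  (forall z, 0 <= f z <= g z) ->
  (Lnorm leb4 2%:E (EFin \o f) <= Lnorm leb4 2%:E (EFin \o g))%E.
Proof.
move=> mf mg fg; rewrite unlock /=; apply: gt0_ler_poweR => //.
- by rewrite in_itv/= leey andbT; apply: integral_ge0 => z _;
  rewrite lee_fin powR_ge0.
- by rewrite in_itv/= leey andbT; apply: integral_ge0 => z _;
  rewrite lee_fin powR_ge0.
apply: ge0_le_integral => //.
- apply/measurable_EFinP; apply: (measurableT_comp (measurable_powR 2)).
  exact: measurableT_comp mf.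
- apply/measurable_EFinP; apply: (measurableT_comp (measurable_powR 2)).
  exact: measurableT_comp mg.
- move=> z _; have /andP[f0 h] := fg z.
  rewrite lee_fin; apply: ge0_ler_powR; rewrite ?nnegrE//.
  by rewrite !ger0_norm// (le_trans f0).
Qed.

(** Squaring doubles the rate. [N] enters through the narrow axis only, whose width 1/N becomes
    N^{-1/2} under the square root. *)
Lemma Lnorm2_gauss4 c A N k l : 0 <= c -> 0 < A -> 0 < N ->
  Lnorm leb4 2%:E (fun z => (c * gauss4 A N k l z)%:E) =
  (c * (pi / (2 * A)) / Num.sqrt N)%:E.
Proof.
move=> c0 A0 N0; rewrite unlock /=.
have A2 : 0 < 2 * A by rewrite mulr_gt0.
rewrite (_ : (fun z => _) = (fun z =>
  (c ^+ 2)%:E * (gauss4 (2 * A) N k l z)%:E)%E); last first.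
  apply/funext => z; rewrite powR_mulrn// -normrX ger0_norm ?sqr_ge0//.
  rewrite -EFinM; congr EFin; rewrite exprMn; congr (_ * _).
  by rewrite /gauss4 -expRM_natl; congr expR; ring.
rewrite integralZl//; last exact: integrable_gauss4.
rewrite [X in (_ * X)%E]integral_gauss4// -EFinM poweR_EFin powR12_sqrt;
  last first.
  by rewrite mulr_ge0 ?divr_ge0 ?sqr_ge0 ?(ltW N0).
congr EFin; rewrite sqrtrM ?sqr_ge0// sqrtr_sqr ger0_norm//.
rewrite -mulrA; congr (_ * _); rewrite sqrtrM ?sqr_ge0// sqrtr_sqr ger0_norm.
  by rewrite sqrtrV// ltW.
by rewrite divr_ge0 ?pi_ge0 ?ltW.
Qed.

End Norms.

(** * Upper and lower bounds for the norms of packets *)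

Section Estimates.
Context {R : realType}.
Local Notation mV := (mspacetime R).

Lemma powRD_gt0 (x r t : R) : 0 < x -> x `^ (r + t) = x `^ r * x `^ t.
Proof. by move=> x0; rewrite powRD// (gt_eqF x0) implybT. Qed.

(** The physical rate N^{-2} on the first axis becomes the Fourier rate N^2 / 4: this is the choice
    of [a] and [b] that gives width 1/N. *)
Lemma wave_profile_narrow (N k l : R) zeta : 0 < N ->
  wave_profile (N ^+ 2)^-1 1 k l zeta = gauss4 4^-1 N k l zeta.
Proof.
move=> N0; rewrite gauss4E /wave_profile mulr1.
by have -> : (4 * (N ^+ 2)^-1)^-1 = 4^-1 * N ^+ 2 by field; rewrite gt_eqF.
Qed.

Lemma wave_profile_narrow2 (N k l : R) zeta : 0 < N ->
  wave_profile (2 * (N ^+ 2)^-1) (2 * 1) k l zeta = gauss4 8^-1 N k l zeta.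
Proof.
move=> N0; rewrite gauss4E /wave_profile mulr1.
have -> : (4 * 2)^-1 = 8^-1 :> R by rewrite -natrM.
by have -> : (4 * (2 * (N ^+ 2)^-1))^-1 = 8^-1 * N ^+ 2 by field;
  rewrite gt_eqF.
Qed.

Lemma wave_mass_narrow (N : R) : 0 < N -> wave_mass (N ^+ 2)^-1 1 = pi ^+ 2 * N.
Proof.
move=> N0; rewrite /wave_mass invrK divr1.
rewrite sqrtrM ?pi_ge0// sqrtr_sqr gtr0_norm//.
have -> : pi ^+ 2 = Num.sqrt pi ^+ 4 :> R
  by rewrite (exprM _ 2 2) sqr_sqrtr ?pi_ge0.
ring.
Qed.

Lemma wave_mass_narrow2 (N : R) : 0 < N ->
  wave_mass (2 * (N ^+ 2)^-1) (2 * 1) = (pi / 2) ^+ 2 * N.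
Proof.
move=> N0; rewrite /wave_mass mulr1.
have p0 : 0 <= pi / 2 :> R by rewrite divr_ge0 ?pi_ge0.
have -> : pi / (2 * (N ^+ 2)^-1) = pi / 2 * N ^+ 2 by field; rewrite gt_eqF.
rewrite (sqrtrM _ p0) sqrtr_sqr gtr0_norm//.
have -> : (pi / 2) ^+ 2 = Num.sqrt (pi / 2) ^+ 4 :> R
  by rewrite (exprM _ 2 2) sqr_sqrtr.
ring.
Qed.

Lemma measurable_gauss4 (A N k l : R) : measurable_fun setT (gauss4 A N k l :
  mV -> R).
Proof.
have [m1 m2 m3 m4] := @measurable_coords R.
apply: measurableT_comp => //; apply: measurableT_comp => //;
  apply: measurable_funM => //.
apply: measurable_funD; last by apply: measurable_funX; exact: measurable_funB.
apply: measurable_funD; last exact: measurable_funX.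
apply: measurable_funD; last exact: measurable_funX.
by apply: measurable_funX; apply: measurable_funM => //; exact: measurable_funB.
Qed.

Lemma measurable_enorm_space : measurable_fun setT (fun z : mV => enorm z.1).
Proof.
by have [m1 m2 m3 _] := @measurable_coords R; exact: measurable_enorm.
Qed.

Lemma measurable_jap_powR (f : mV -> R) (m : R) : measurable_fun setT f ->
  measurable_fun setT (fun z => jap (f z) `^ m).
Proof.
move=> mf; apply: (measurableT_comp (measurable_powR m)).
apply: measurable_sqrt_ge0 => [z|]; first by rewrite addr_ge0 ?sqr_ge0.
by apply: measurable_funD => //; exact: measurable_funX.
Qed.

Lemma normc_real (r : R) : 0 <= r -> Normc.normc r%:C = r.
Proof. by move=> r0; rewrite /Normc.normc /= expr0n/= addr0 sqrtr_sqr
  ger0_norm. Qed.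

Lemma weighted_normE (phi : spacetime R -> R) (m b : R) f (g : mV -> R) :
  (forall z, 0 <= g z) -> (forall z, fourier f z = (g z)%:C) ->
  weighted_norm phi m b f =
  Lnorm leb4 2%:E (EFin \o (fun z : mV =>
    jap (enorm z.1) `^ m * jap (phi z) `^ b * g z)).
Proof.
move=> g0 fg; apply: eq_Lnorm => z.
by rewrite fg normc_real.
Qed.

(** Mass of order N times the Gaussian norm N^{-1/2} gives [Num.sqrt N], and <k>^s is replaced by
    N^s. The lower bound on [|k|] is what negative [s] requires there. *)
Lemma Xnorm_wavepacket_le (s b : R) : 0 <= b -> exists2 C : R, 0 < C &
  forall N k, 1 <= N -> N / 4 <= `|k| <= N ->
  (Xnorm s b (wavepacket (N ^+ 2)^-1 1 k (- k ^+ 2)) <=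
   (C * (N `^ s * Num.sqrt N))%:E)%E.
Proof.
move=> b0; have p0 : 0 <= `|s| + b by rewrite addr_ge0.
have e0 : 0 < 8^-1 :> R by rewrite invr_gt0.
have [C1 C10 hC1] := @powR_le_expR R 4 (`|s| + b) 8^-1 (ltr0Sn _ _) p0 e0.
(* In order: the cost of replacing <k>^s by N^s, the absorption of both weights, the mass, and the
   L^2 norm of a Gaussian of rate 1/8. *)
pose C := 4 `^ `|s| * C1 * pi ^+ 2 * (pi / (2 * 8^-1)).
exists C; first by rewrite /C !mulr_gt0 ?powR_gt0 ?exprn_gt0 ?pi_gt0.
move=> N k N1 /andP[kN1 kN2]; have N0 : 0 < N by exact: lt_le_trans N1.
have a0 : 0 < (N ^+ 2)^-1 by rewrite invr_gt0 exprn_gt0.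
pose l := - k ^+ 2.
pose g (z : mV) := pi ^+ 2 * N * gauss4 4^-1 N k l z.
have mass0 : 0 < pi ^+ 2 * N by rewrite mulr_gt0 ?exprn_gt0 ?pi_gt0.
have g0 z : 0 <= g z by exact: mulr_ge0 (ltW mass0) (expR_ge0 _).
have fE z : fourier (wavepacket (N ^+ 2)^-1 1 k l) z = (g z)%:C.
  by rewrite fourier_wavepacket// wave_mass_narrow// wave_profile_narrow.
rewrite /Xnorm (weighted_normE _ _ _ g0 fE).
pose c := jap k `^ s * C1 * (pi ^+ 2 * N).
have c0 : 0 <= c by exact: mulr_ge0 (mulr_ge0 (powR_ge0 _ _) (ltW C10)) (ltW
  mass0).
apply: (@le_trans _ _ (Lnorm leb4 2%:E (EFin \o (fun z : mV =>
  c * gauss4 8^-1 N k l z)))).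
  apply: Lnorm2_le.
  - apply: measurable_funM; first apply: measurable_funM.
    + apply: measurable_jap_powR; exact: measurable_enorm_space.
    + apply: measurable_jap_powR; apply: measurable_funD;
      first exact: measurable_snd.
      by apply: measurable_funX; exact: measurable_enorm_space.
    + by apply: measurable_funM => //; exact: measurable_gauss4.
  - by apply: measurable_funM => //; exact: measurable_gauss4.
  move=> z; rewrite (mulr_ge0 (mulr_ge0 (powR_ge0 _ _) (powR_ge0 _ _)) (g0 z))
    /=.
  have D0 : 0 <= deviation N k l z by exact: deviation_ge0.
  have T0 : 0 < 2 * (1 + deviation N k l z) by lra.
  have T1 : 1 <= 4 * (1 + deviation N k l z) by lra.
  have [j1 j2] := jap_enorm_comparable k l z N1.
  have w1 := powR_comparable s (jap_gt0 _) (jap_gt0 _) T0 j1 j2.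
  have w1' : jap (enorm z.1) `^ s <= jap k `^ s * (4 * (1 + deviation N k l z))
    `^ `|s|.
    apply: le_trans w1 _; rewrite ler_wpM2l ?powR_ge0//.
    by apply: ge0_ler_powR; rewrite ?nnegrE//; lra.
  have w2 : jap (z.2 + enorm z.1 ^+ 2) `^ b <= (4 * (1 + deviation N k l z)) `^
    b.
    apply: ge0_ler_powR; rewrite ?nnegrE ?(ltW (jap_gt0 _))//; first by lra.
    exact: jap_phase_le.
  have w3 := hC1 _ D0.
  apply: (@le_trans _ _ (jap k `^ s * (C1 * expR (8^-1 * deviation N k l z)) *
    g z)).
    rewrite ler_wpM2r//; apply: (@le_trans _ _ (jap k `^ s * (4 * (1 +
      deviation N k l z)) `^ `|s| * (4 * (1 + deviation N k l z)) `^ b)).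
      by apply: ler_pM; rewrite ?powR_ge0.
    have F0 : 0 < 4 * (1 + deviation N k l z) by lra.
    rewrite (powRD_gt0 _ _ F0) in w3.
    by rewrite -mulrA; apply: ler_wpM2l w3; exact: powR_ge0.
  rewrite /g /c /gauss4 le_eqVlt; apply/orP; left; apply/eqP.
  (* One half of the exponent cancels the growth of the weights, the other half is the comparison
     Gaussian. *)
  have -> : - (4^-1 * deviation N k l z) = - (8^-1 * deviation N k l z) + -
    (8^-1 * deviation N k l z) by field.
  rewrite [in LHS]expRD expRN; field.
  by rewrite gt_eqF ?expR_gt0.
rewrite (_ : EFin \o _ = (fun z =>
  (c * gauss4 8^-1 N k l z)%:E))// Lnorm2_gauss4// lee_fin.
have Ns : 0 < Num.sqrt N by rewrite sqrtr_gt0.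
have jk : jap k `^ s <= N `^ s * 4 `^ `|s|.
  apply: powR_comparable; rewrite ?jap_gt0//.
  - apply: jap_le; first by rewrite mulr_ge0// ltW.
    rewrite -(real_normK (num_real k)).
    have := normr_ge0 k; nra.
  - rewrite -ler_pdivrMr//; apply: (le_trans kN1).
    by rewrite -sqrtr_sqr ler_wsqrtr// lerDr.
apply: (@le_trans _ _ ((N `^ s * 4 `^ `|s|) * C1 * (pi ^+ 2 * N) * (pi / (2 *
  8^-1)) / Num.sqrt N)).
  rewrite /c !ler_wpM2r// ?invr_ge0 ?(ltW Ns) ?(ltW C10)//.
  - by rewrite divr_ge0 ?pi_ge0.
  - exact: ltW mass0.
rewrite le_eqVlt; apply/orP; left; apply/eqP; rewrite /C.
have -> : pi ^+ 2 * N = pi ^+ 2 * (Num.sqrt N * Num.sqrt N)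
  by rewrite -expr2 sqr_sqrtr ?(ltW N0).
field; rewrite gt_eqF//.
Qed.

(** The symbol of A^{-1/2} is <xi>^{-1}, whence [sigma - 1]. As the exponent [- b'] is not positive,
    a lower bound of this weight needs only the upper bound [jap_cone_le]. *)
Lemma Xpm_norm_wavepacket_ge (e : bool) (sigma b' : R) : 0 <= b' ->
  exists2 c : R, 0 < c & forall N m, 1 <= N -> 0 <= m ->
  ((c * (jap m `^ (sigma - 1) * Num.sqrt N))%:E <=
   Xpm_norm e sigma (- b') (powA (- 2^-1)
     (wavepacket (2 * (N ^+ 2)^-1) (2 * 1) m (- ((-1) ^+ e * m)))))%E.
Proof.
move=> b0; have p0 : 0 <= `|sigma - 1| + b' by rewrite addr_ge0.
have e0 : 0 < 8^-1 :> R by rewrite invr_gt0.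
have [C1 C10 hC1] := @powR_le_expR R 4 (`|sigma - 1| + b') 8^-1 (ltr0Sn _ _) p0
  e0.
exists (C1^-1 * (pi / 2) ^+ 2 * (pi / (2 * 4^-1))).
  by rewrite !mulr_gt0 ?invr_gt0 ?exprn_gt0 ?divr_gt0 ?pi_gt0.
move=> N m N1 m0; have N0 : 0 < N by exact: lt_le_trans N1.
have a0 : 0 < 2 * (N ^+ 2)^-1 by rewrite mulr_gt0 ?invr_gt0 ?exprn_gt0.
have b20 : 0 < 2 * 1 :> R by rewrite mulr_gt0.
pose l := - ((-1) ^+ e * m).
pose g (z : mV) := symbolA z.1 `^ (- 2^-1) * ((pi / 2) ^+ 2 * N) * gauss4 8^-1
  N m l z.
have mass0 : 0 < (pi / 2) ^+ 2 * N
  by rewrite mulr_gt0 ?exprn_gt0 ?divr_gt0 ?pi_gt0.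
have g0 z : 0 <= g z.
  exact: mulr_ge0 (mulr_ge0 (powR_ge0 _ _) (ltW mass0)) (expR_ge0 _).
have fE z : fourier (powA (- 2^-1) (wavepacket (2 * (N ^+ 2)^-1) (2 * 1) m l))
  z = (g z)%:C.
  by rewrite fourier_powA_wavepacket// wave_mass_narrow2// wave_profile_narrow2.
rewrite /Xpm_norm (weighted_normE _ _ _ g0 fE).
pose c := jap m `^ (sigma - 1) * C1^-1 * ((pi / 2) ^+ 2 * N).
have C1i : 0 <= C1^-1 by rewrite invr_ge0 ltW.
have c0 : 0 <= c by exact: mulr_ge0 (mulr_ge0 (powR_ge0 _ _) C1i) (ltW mass0).
apply: (@le_trans _ _ (Lnorm leb4 2%:E (EFin \o (fun z : mV =>
  c * gauss4 4^-1 N m l z)))).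
  rewrite (_ : EFin \o _ = (fun z =>
    (c * gauss4 4^-1 N m l z)%:E))// Lnorm2_gauss4// lee_fin.
  have Ns : 0 < Num.sqrt N by rewrite sqrtr_gt0.
  rewrite le_eqVlt; apply/orP; left; apply/eqP; rewrite /c.
  have -> : (pi / 2) ^+ 2 * N = (pi / 2) ^+ 2 * (Num.sqrt N * Num.sqrt N).
    by rewrite -expr2 sqr_sqrtr ?(ltW N0).
  by field; rewrite !gt_eqF.
apply: Lnorm2_le.
- by apply: measurable_funM => //; exact: measurable_gauss4.
- have mS : measurable_fun setT (fun z : mV => symbolA z.1 `^ (- 2^-1)).
    apply: (measurableT_comp (measurable_powR _)); apply: measurable_funD => //.
    by apply: measurable_funX; exact: measurable_enorm_space.
  apply: measurable_funM; first apply: measurable_funM.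
  + apply: measurable_jap_powR; exact: measurable_enorm_space.
  + apply: measurable_jap_powR; apply: measurable_funD;
    first exact: measurable_snd.
    by apply: measurable_funM => //; exact: measurable_enorm_space.
  + apply: measurable_funM; last exact: measurable_gauss4.
    by apply: measurable_funM.
move=> z; rewrite (mulr_ge0 c0 (expR_ge0 _)) /=.
have D0 : 0 <= deviation N m l z by exact: deviation_ge0.
set D := deviation N m l z in D0 *.
have T0 : 0 < 2 * (1 + D) by lra.
have F0 : 0 < 4 * (1 + D) by lra.
have [j1 j2] := jap_enorm_comparable m l z N1.
have w1 := powR_comparable (sigma - 1) (jap_gt0 _) (jap_gt0 _) T0 j2 j1.
have SE : symbolA z.1 `^ (- 2^-1) = jap (enorm z.1) `^ (- 1).
  have S0 : 0 <= symbolA z.1 by rewrite (le_trans _ (symbolA_ge1 _)).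
  by rewrite !powRN powR12_sqrt// powRr1 ?(ltW (jap_gt0 _))// /jap /symbolA
    addrC.
have w1' : jap m `^ (sigma - 1) <= jap (enorm z.1) `^ sigma * symbolA z.1 `^ (-
  2^-1) * (4 * (1 + D)) `^ `|sigma - 1|.
  rewrite SE -powRD_gt0 ?jap_gt0//.
  apply: le_trans w1 _; rewrite ler_wpM2l ?powR_ge0//.
  by apply: ge0_ler_powR; rewrite ?nnegrE//; lra.
have w2 : 1 <= jap (z.2 + (-1) ^+ e * enorm z.1) `^ (- b') * (4 * (1 + D)) `^
  b'.
  rewrite powRN mulrC ler_pdivlMr ?powR_gt0 ?jap_gt0// mul1r.
  apply: ge0_ler_powR; rewrite ?nnegrE ?(ltW (jap_gt0 _)) ?(ltW F0)//.
  exact: jap_cone_le.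
have w3 := hC1 _ D0.
set X := jap (enorm z.1) `^ sigma in w1' *; set Y := jap _ `^ (- b') in w2 *.
set S := symbolA z.1 `^ _ in w1' *; set E := expR (8^-1 * D) in w3.
have X0 : 0 <= X by exact: powR_ge0.
have Y0 : 0 <= Y by exact: powR_ge0.
have S0 : 0 <= S by exact: powR_ge0.
have E0 : 0 < E by exact: expR_gt0.
have M0 : 0 <= jap m `^ (sigma - 1) by exact: powR_ge0.
have key : jap m `^ (sigma - 1) <= X * S * Y * (C1 * E).
  apply: (@le_trans _ _ (X * S * Y * ((4 * (1 + D)) `^ (`|sigma - 1| + b')))).
    rewrite [in leRHS]powRD_gt0//.
    apply: (@le_trans _ _ ((X * S * (4 * (1 + D)) `^ `|sigma - 1|) * (Y * (4 *
      (1 + D)) `^ b'))).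
      by rewrite -[leLHS]mulr1; apply: ler_pM.
    by rewrite le_eqVlt; apply/orP; left; apply/eqP; ring.
  by apply: ler_wpM2l w3; exact: mulr_ge0 (mulr_ge0 X0 S0) Y0.
rewrite /g /c /gauss4 -/D -/S.
(* Here one factor e^{-D/8} is the packet itself, and the other bounds the weights from below. *)
have -> : - (4^-1 * D) = - (8^-1 * D) + - (8^-1 * D) by field.
rewrite expRD expRN -/E.
have -> : X * Y * (S * ((pi / 2) ^+ 2 * N) * E^-1) =
  (X * S * Y) * (((pi / 2) ^+ 2 * N) * E^-1) by ring.
have -> : jap m `^ (sigma - 1) * C1^-1 * ((pi / 2) ^+ 2 * N) * (E^-1 * E^-1) =
  (jap m `^ (sigma - 1) / (C1 * E)) * (((pi / 2) ^+ 2 * N) * E^-1).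
  by field; rewrite !gt_eqF.
rewrite ler_wpM2r ?ler_pdivrMr ?mulr_gt0//.
by rewrite mulr_ge0 ?invr_ge0 ?(ltW mass0) ?(ltW E0).
Qed.

End Estimates.

(** * Choice of frequencies and contradiction *)

Section Counterexample.
Context {R : realType}.

Lemma powR_unbounded (delta K : R) : 0 < delta ->
  ~ (forall N : R, 4 <= N -> N `^ delta <= K).
Proof.
move=> d0 h; have K1 : 0 < `|K| + 1 by rewrite ltr_wpDl.
(* The second summand has [delta]-th power equal to [|K| + 1], which exceeds [K]; the 4 secures the
   threshold. *)
pose N := 4 + (`|K| + 1) `^ delta^-1.
have := h N; rewrite lerDl powR_ge0 => /(_ isT); apply/negP; rewrite -ltNge.
apply: (@lt_le_trans _ _ (`|K| + 1)).
  by rewrite (le_lt_trans (ler_norm K))// ltrDl.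
have N0 : 0 <= N by rewrite /N addr_ge0 ?powR_ge0.
have KN : (`|K| + 1) `^ delta^-1 <= N by rewrite /N lerDr.
have -> : `|K| + 1 = ((`|K| + 1) `^ delta^-1) `^ delta.
  by rewrite -powRrM mulVf ?gt_eqF// powRr1 ?(ltW K1).
by apply: ge0_ler_powR; rewrite ?nnegrE ?powR_ge0 ?(ltW d0).
Qed.

(** The condition on [k1 ^+ 2 - k2 ^+ 2] puts the product packet on the light cone of sign [e],
    where [Xpm_norm_wavepacket_ge] applies with [m = k1 - k2]. *)
Lemma bilinear_estimate_wavepacket (e : bool) (sigma s b' b1 b2 : R) :
  0 <= b' -> 0 <= b1 -> 0 <= b2 -> bilinear_estimate e sigma s b' b1 b2 ->
  exists K : R, forall N k1 k2, 1 <= N ->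
    N / 4 <= `|k1| <= N -> N / 4 <= `|k2| <= N -> 0 <= k1 - k2 ->
    k1 ^+ 2 - k2 ^+ 2 = (-1) ^+ e * (k1 - k2) ->
    jap (k1 - k2) `^ (sigma - 1) <= K * N `^ (2 * s + 2^-1).
Proof.
move=> b'0 b10 b20 [C est].
have [C1 C10 h1] := Xnorm_wavepacket_le s b10.
have [C2 C20 h2] := Xnorm_wavepacket_le s b20.
have [c c0 h3] := Xpm_norm_wavepacket_ge e sigma b'0.
exists (c^-1 * (`|C| * C1 * C2)) => N k1 k2 N1 hk1 hk2 m0 ke.
have N0 : 0 < N by exact: lt_le_trans N1.
have a0 : 0 < (N ^+ 2)^-1 by rewrite invr_gt0 exprn_gt0.
have x1 := h1 N k1 N1 hk1; have x2 := h2 N k2 N1 hk2.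
have x3 := h3 N (k1 - k2) N1 m0.
have := est _ _ (schwartz_wavepacket k1 (- k1 ^+ 2) a0 ltr01)
  (schwartz_wavepacket k2 (- k2 ^+ 2) a0 ltr01).
under [X in powA _ X]eq_fun do rewrite wavepacket_mul_conj.
have -> : - k1 ^+ 2 - - k2 ^+ 2 = - ((-1) ^+ e * (k1 - k2)) by rewrite -ke;
  ring.
move=> x4; have {x3 x4} := le_trans x3 x4.
set X1 := Xnorm _ _ _ in x1 *; set X2 := Xnorm _ _ _ in x2 *.
have X10 : (0 <= X1)%E by exact: Lnorm_ge0.
have X20 : (0 <= X2)%E by exact: Lnorm_ge0.
set r := N `^ s * Num.sqrt N in x1 x2.
have r0 : 0 < r by rewrite mulr_gt0 ?powR_gt0 ?sqrtr_gt0.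
(* The constant of the assumed estimate may be negative, so [|C|] takes its place before the factors
   are bounded. *)
have x5 : (C%:E * X1 * X2 <= (`|C| * (C1 * r) * (C2 * r))%:E)%E.
  have CX0 : (0 <= `|C|%:E * X1)%E by rewrite mule_ge0.
  apply: (@le_trans _ _ (`|C|%:E * X1 * X2)%E).
    by apply: lee_wpmul2r => //; apply: lee_wpmul2r => //;
      rewrite lee_fin ler_norm.
  rewrite EFinM; apply: lee_pmul => //; rewrite EFinM.
  exact: lee_wpmul2l.
move=> /le_trans /(_ x5); rewrite lee_fin => x6.
have Ns : 0 < Num.sqrt N by rewrite sqrtr_gt0.
have NE : N `^ (2 * s + 2^-1) = N `^ s * N `^ s * Num.sqrt N.
  have -> : 2 * s + 2^-1 = s + s + 2^-1 by ring.
  by rewrite !powRD_gt0// powR12_sqrt// ltW.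
rewrite NE -(ler_pM2r Ns) -(ler_pM2l c0); apply: le_trans x6 _.
rewrite le_eqVlt /r; apply/orP; left; apply/eqP; field.
by rewrite gt_eqF.
Qed.

Lemma bilinear_estimate_high_freq (e : bool) (sigma s b' b1 b2 : R) :
  0 <= b' -> 0 <= b1 -> 0 <= b2 -> 0 < sigma - 2 * s - 3 / 2 ->
  ~ bilinear_estimate e sigma s b' b1 b2.
Proof.
move=> b'0 b10 b20 d0 /(bilinear_estimate_wavepacket b'0 b10 b20)[K hK].
apply: (@powR_unbounded _ (K * 2 `^ `|sigma - 1|) d0) => N N4.
have N0 : 0 < N by exact: lt_le_trans N4.
have N1 : 1 <= N by apply: le_trans N4; rewrite ler1n.
pose eps : R := (-1) ^+ e.
have e1 : `|eps| <= 1 by rewrite normrX normrN1 expr1n.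
have e2 : eps ^+ 2 = 1 by rewrite sqrr_sign.
have [e3 e4] : - 1 <= eps /\ eps <= 1 by move: e1; rewrite ler_norml => /andP.
(* The frequencies solve [k1 - k2 = N] and [k1 + k2 = eps], so [k1^2 - k2^2 = eps * N]. They have
   opposite signs and size about [N / 2], within the allowed range because [N >= 4]. *)
have k1N : N / 4 <= `|(N + eps) / 2| <= N.
  by rewrite ger0_norm; [apply/andP; split; lra|lra].
have k2N : N / 4 <= `|(eps - N) / 2| <= N.
  by rewrite ler0_norm; [apply/andP; split; lra|lra].
have mE : (N + eps) / 2 - (eps - N) / 2 = N by field.
have := hK N _ _ N1 k1N k2N; rewrite mE => /(_ (ltW N0)) hN.
have {}hN : jap N `^ (sigma - 1) <= K * N `^ (2 * s + 2^-1).
  by apply: hN; rewrite -/eps; field.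
have jN : N `^ (sigma - 1) <= jap N `^ (sigma - 1) * 2 `^ `|sigma - 1|.
  apply: powR_comparable => //; first exact: jap_gt0.
    have j1 : N <= jap N by rewrite -[leLHS](gtr0_norm N0) -sqrtr_sqr
      ler_wsqrtr// lerDr.
    by have := jap_gt0 N; lra.
  by apply: jap_le; nra.
have P0 : 0 < N `^ (2 * s + 2^-1) by exact: powR_gt0.
have -> : sigma - 2 * s - 3 / 2 = (sigma - 1) + - (2 * s + 2^-1) by field.
rewrite powRD_gt0// (powRN N) ler_pdivrMr//; apply: (le_trans jN).
have -> : K * 2 `^ `|sigma - 1| * N `^ (2 * s + 2^-1) =
  K * N `^ (2 * s + 2^-1) * 2 `^ `|sigma - 1| by ring.
by rewrite ler_wpM2r ?powR_ge0.
Qed.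

Lemma bilinear_estimate_low_freq (e : bool) (sigma s b' b1 b2 : R) :
  0 <= b' -> 0 <= b1 -> 0 <= b2 -> s < - (1 / 4) ->
  ~ bilinear_estimate e sigma s b' b1 b2.
Proof.
move=> b'0 b10 b20 s0 /(bilinear_estimate_wavepacket b'0 b10 b20)[K hK].
have d0 : 0 < - (2 * s + 2^-1) by lra.
apply: (@powR_unbounded _ K d0) => N N4.
have N0 : 0 < N by exact: lt_le_trans N4.
have N1 : 1 <= N by apply: le_trans N4; rewrite ler1n.
have kN : N / 4 <= `|N| <= N by rewrite gtr0_norm//; apply/andP; split; lra.
(* With equal frequencies the cone condition reads 0 = 0, and the left side is <0>^{sigma-1} = 1 for
   every [sigma], leaving [1 <= K * N^(2 * s + 2^-1)]. *)
have := hK N N N N1 kN kN; rewrite !subrr mulr0 lexx => /(_ isT erefl).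
rewrite /jap expr0n/= addr0 sqrtr1 powR1 => hN.
have P0 : 0 < N `^ (2 * s + 2^-1) by exact: powR_gt0.
by rewrite powRN -(ler_pM2r P0) mulVf ?gt_eqF.
Qed.

End Counterexample.

Theorem proposition4p2 :
  forall (R : realType),
    (forall (e : bool) (sigma s b' b1 b2 : R),
       0 <= b' -> 0 <= b1 -> 0 <= b2 -> 0 < sigma - 2 * s - 3 / 2 ->
       ~ bilinear_estimate e sigma s b' b1 b2) /\
    (forall (e : bool) (sigma s b' b1 b2 : R),
       0 <= b' -> 0 <= b1 -> 0 <= b2 -> s < - (1 / 4) ->
       ~ bilinear_estimate e sigma s b' b1 b2).
Proof.
by move=> R; split; [exact: bilinear_estimate_high_freq|exact: bilinear_estimate_low_freq].
Qed.
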